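(* Let $n\ge 3$. A permutation $\tau$ of length $n$ is $3$-inflatable if and only if all of the following hold: $$t(12, \tau) = \frac12,$$ $$t(123, \tau) = t(321, \tau) = \frac{2n-7}{12(n-2)},$$ $$t(132, \tau) = t(213, \tau) = t(231, \tau) = t(312, \tau) = \frac{4n-5}{24(n-2)}.$$
   Context: A permutation of length $n\ge 1$ is a bijection of $[n]=\{1,\dots,n\}$, written as the tuple (word) of its values; $S_n$ is the set of these and $|\tau|$ denotes the length of $\tau$. A tuple $(a_1,\dots,a_k)$ of distinct integers is order-isomorphic to $\pi\in S_k$ if $a_i<a_j \iff \pi(i)<\pi(j)$ for all $i,j$. The density $t(\pi,\tau)$ of $\pi\in S_k$ in a permutation $\tau$ with $|\tau|\ge k$ is the probability that the restriction of $\tau$ to a uniformly random $k$-element subset of its indices (listed in increasing order of index) is order-isomorphic to $\pi$. Tensor product: for $\tau\in S_n$, $\gamma\in S_m$, $\tau[\gamma]\in S_{nm}$ is given by $\tau[\gamma]((i-1)m+j)=(\tau(i)-1)m+\gamma(j)$ for $i\in[n]$, $j\in[m]$. The random inflation of $\tau$ is the sequence of random permutations $\tau[\lambda_1],\tau[\lambda_2],\ldots$, where $\lambda_\ell$ is uniformly distributed on $S_\ell$ for each $\ell\ge1$ (all on a common probability space). A sequence of permutations $\{\tau_j\}$ with $|\tau_j|\to\infty$ whose pattern densities $t(\pi,\tau_j)$ all converge is called $k$-symmetric if $\lim_{j} t(\pi,\tau_j)=1/k!$ for every $\pi\in S_k$. A permutation $\tau$ is $k$-inflatable if its random inflation is (almost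 surely) $k$-symmetric. *)

(* Defs.v *)
From mathcomp Require Import all_boot all_order all_algebra all_fingroup.
From mathcomp Require Import all_classical all_reals all_analysis.

Set Implicit Arguments.
Unset Strict Implicit.
Unset Printing Implicit Defensive.

Import Order.TTheory GRing.Theory Num.Theory.
Import numFieldNormedType.Exports.

Local Open Scope ring_scope.

(* Permutations of [n] are elements of 'S_n: positions and values are shifted
   down by one, to {0, ..., n-1}. *)

(* One-line notation with the usual 1-based values.  The default value 1%g is
   only reached when w is not a word of a permutation, see onelineE. *)
Definition oneline (w : seq nat) : 'S_(size w) :=
  insubd (1%g : 'S_(size w))
    [ffun i : 'I_(size w) => insubd i (nth 0%N w i).-1].

Lemma onelineE (w : seq nat) (i : 'I_(size w)) :
  perm_eq w (iota 1 (size w)) -> (oneline w i).+1 = nth 0%N w i.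
Proof.
move=> pw.
have wP j : (j < size w)%N -> (0 < nth 0%N w j <= size w)%N.
  move=> jw; have := mem_nth 0%N jw.
  by rewrite (perm_mem pw) mem_iota add1n ltnS.
set f := [ffun i : 'I_(size w) => insubd i (nth 0%N w i).-1].
have fE j : (f j).+1 = nth 0%N w j.
  have /andP[h0 h1] := wP j (ltn_ord j).
  by rewrite ffunE val_insubd prednK // h1 prednK.
have f_inj : injectiveb f.
  apply/injectiveP => j k jk; apply/val_inj/eqP.
  rewrite -(nth_uniq 0%N (ltn_ord j) (ltn_ord k)) -?fE ?jk //.
  by rewrite (perm_uniq pw) iota_uniq.
rewrite -fE; congr (nat_of_ord _).+1.
by rewrite -pvalE insubdK.
Qed.

Definition order_isomorphic (k : nat) (a : 'I_k -> nat) (pi : 'S_k) : bool :=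
  [forall i, forall j, (a i < a j)%N == (pi i < pi j)%N].

(* enum A lists A in increasing order. *)
Definition restriction (n : nat) (tau : 'S_n) (A : {set 'I_n}) (i : nat) : nat :=
  nth 0%N [seq val (tau x) | x <- enum A] i.

(* Meaningful for k <= n; equal to 0 when n < k. *)
Definition density (R : realType) (k n : nat) (pi : 'S_k) (tau : 'S_n) : R :=
  #|[set A : {set 'I_n} | (#|A| == k)
      && order_isomorphic (restriction tau A) pi]|%:R / 'C(n, k)%:R.

Section Tensor.
Variables n m : nat.

Lemma block_subproof (x : 'I_(n * m)) : (x %/ m < n)%N.
Proof. by rewrite ltn_divLR ?ltn_ord //; case: m x => // -[y]; rewrite muln0. Qed.

Lemma offset_subproof (x : 'I_(n * m)) : (x %% m < m)%N.
Proof. by rewrite ltn_mod; case: m x => // -[y]; rewrite muln0. Qed.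

Lemma index_subproof (i : 'I_n) (j : 'I_m) : (i * m + j < n * m)%N.
Proof.
apply: leq_trans (leq_mul (ltn_ord i) (leqnn m)).
by rewrite mulSn addnC ltn_add2r.
Qed.

(* index_of i j is the position written (i-1)m+j with 1-based i and j. *)
Definition block (x : 'I_(n * m)) : 'I_n := Ordinal (block_subproof x).
Definition offset (x : 'I_(n * m)) : 'I_m := Ordinal (offset_subproof x).
Definition index_of (i : 'I_n) (j : 'I_m) : 'I_(n * m) :=
  Ordinal (index_subproof i j).

Lemma block_index (i : 'I_n) (j : 'I_m) : block (index_of i j) = i.
Proof.
apply: val_inj; rewrite /= divnMDl ?divn_small ?addn0 //.
exact: leq_ltn_trans (ltn_ord j).
Qed.

Lemma offset_index (i : 'I_n) (j : 'I_m) : offset (index_of i j) = j.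
Proof. by apply: val_inj; rewrite /= modnMDl modn_small. Qed.

Lemma index_block_offset (x : 'I_(n * m)) : index_of (block x) (offset x) = x.
Proof. by apply: val_inj; rewrite /= -divn_eq. Qed.

Lemma tensor_inj (tau : 'S_n) (gam : 'S_m) :
  injective (fun x => index_of (tau (block x)) (gam (offset x))).
Proof.
move=> x y e; rewrite -(index_block_offset x) -(index_block_offset y).
move/(congr1 block): (e); rewrite !block_index => /perm_inj ->.
by move/(congr1 offset): e; rewrite !offset_index => /perm_inj ->.
Qed.

Definition tensor (tau : 'S_n) (gam : 'S_m) : 'S_(n * m) :=
  perm (@tensor_inj tau gam).

Lemma tensorE (tau : 'S_n) (gam : 'S_m) (i : 'I_n) (j : 'I_m) :
  tensor tau gam (index_of i j) = (tau i * m + gam j)%N :> nat.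
Proof. by rewrite permE block_index offset_index. Qed.

End Tensor.

Local Open Scope classical_set_scope.

Definition symmetric_seq (R : realType) (k : nat) (N : nat -> nat)
    (s : forall j, 'S_(N j)) : Prop :=
  [/\ N @ \oo --> \oo,
      forall (m : nat) (pi : 'S_m), (0 < m)%N ->
        cvg (density R pi (s j) @[j --> \oo]) &
      forall pi : 'S_k,
        density R pi (s j) @[j --> \oo] --> ((k`!)%:R^-1 : R)].

(* The singletons generate the discrete sigma-algebra on the finite type 'S_l,
   so the first clause is measurability of the random permutation X. *)
Definition uniform_perm (R : realType) (d : measure_display)
    (Omega : measurableType d) (P : probability Omega R) (l : nat)
    (X : Omega -> 'S_l) : Prop :=
  forall s : 'S_l, measurable (X @^-1` [set s]) /\
    P (X @^-1` [set s]) = ((l`!)%:R^-1)%:E.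

(* lambda l is the random permutation of length l + 1; its law enters through
   uniform_perm, and the joint law of the family is left arbitrary. *)
Definition inflatable (R : realType) (d : measure_display)
    (Omega : measurableType d) (P : probability Omega R)
    (lambda : forall l : nat, Omega -> 'S_l.+1) (k n : nat) (tau : 'S_n) : Prop :=
  {ae P, forall w, symmetric_seq R k (fun l => tensor tau (lambda l w))}.

(* Main.v *)
Require Import Defs.
From mathcomp Require Import all_boot all_order all_algebra all_fingroup.
From mathcomp Require Import all_classical all_reals all_analysis.
From mathcomp Require Import ring lra zify.

(** Cut the positions of [tau[gam]], with [gam] of length [l], into [n] blocks
    of [l]. A [k]-tuple of positions is a pair [(b, o)] of block indices and
    offsets, and the relative orders of the positions and of their values are
    lexicographic: block first, then offset. When [o] is injective, as all but
    a negligible proportion of the offset tuples are, whether [(b, o)] is an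
    occurrence of [pi] therefore depends only on [b], on the order type [r] of
    [o] and on the order type [s] of [gam o]. If, for every [r] and [s], a
    proportion close to [1 / k!^2] of all offset tuples has the order types
    [r] and [s], the density of [pi] in [tau[gam]] is close to [W / (k! n^k)],
    where [W] ([limit_weight]) counts the triples [(b, r, s)] that give an
    occurrence ([density_tensor_cvg]).

    A uniform permutation [gam] has this property almost surely along the
    whole sequence, whatever the joint law. The restrictions of [gam] to
    disjoint sets of positions have independent order types
    ([sum_order_isomorphic_indep]), so in the fourth moment of the deviation
    only the quadruples of offset tuples in which none is disjoint from the
    other three contribute; they are a fraction [O(l^-2)] of all
    ([fourth_moment], [deviation_moment]). Markov's inequality gives tails of
    order [l^-2], which are summable, and the Borel-Cantelli lemma concludes
    ([ae_deviation_cvg]). The exponent matters: the second moment would only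
    give tails of order [1 / l]. Consequently [tau] is [k]-inflatable if and
    only if [W = n^k] for every [pi] of length [k] ([inflatableP]).

    For [k = 3] a nondecreasing triple of blocks is strictly increasing, has
    exactly two equal members, or is constant, and these cases contribute
    [W = 36 N + 9 (c + c') + n] ([limit_weightE]), where [N] is the number of
    occurrences of [pi] in [tau] and each of [c] and [c'] is, according to
    [pi], [0] or the number of ascents or of descents of [tau] (over all pairs
    of positions, adjacent or not). The six equations [W = n^3], together with
    the count of ascents through the triples that contain them
    ([pair_count_triples]), form a linear system whose only solution is the
    one in the theorem ([density_equationsP]). *)

Set Implicit Arguments.
Unset Strict Implicit.
Unset Printing Implicit Defensive.

Import Order.TTheory GRing.Theory Num.Theory.
Import numFieldNormedType.Exports.

Local Open Scope ring_scope.

(** * Patterns of injective words *)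

Section Patterns.
Variable k : nat.
Implicit Types (a : 'I_k -> nat) (r s : 'S_k).

Lemma order_isomorphicP a r :
  reflect (forall i j, (a i < a j)%N = (r i < r j)%N) (order_isomorphic a r).
Proof.
apply: (iffP forallP) => [h i j|h i]; first by move: (h i) => /forallP /(_ j) /eqP.
by apply/forallP => j; rewrite h.
Qed.

Lemma eq_order_isomorphic a a' r :
  a =1 a' -> order_isomorphic a r = order_isomorphic a' r.
Proof. by move=> aa'; do 2![apply: eq_forallb => ?]; rewrite !aa'. Qed.

Lemma order_isomorphic_inj a r : order_isomorphic a r -> injective a.
Proof.
move=> /order_isomorphicP h i j aij; apply: (@perm_inj _ r).
apply/val_inj/eqP; rewrite eqn_leq leqNgt -h aij ltnn.
by rewrite leqNgt -h aij ltnn.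
Qed.

(** The order type of an injective word sends a position to the number of
    smaller letters; the bound makes this number an element of ['I_k]. *)
Lemma rank_subproof a (i : 'I_k) : (#|[set j | (a j < a i)%N]| < k)%N.
Proof.
rewrite -[X in (_ < X)%N]card_ord -cardsT; apply: proper_card.
by rewrite properT; apply/eqP => /setP /(_ i); rewrite !inE ltnn.
Qed.

Lemma rank_lt a i j : (a i < a j)%N ->
  (#|[set l | (a l < a i)%N]| < #|[set l | (a l < a j)%N]|)%N.
Proof.
move=> ij; apply: proper_card; apply/properP; split.
  by apply/fintype.subsetP => l; rewrite !inE => li; apply: ltn_trans ij.
by exists i; rewrite !inE ?ltnn.
Qed.

Lemma order_isomorphic_ex a : injective a -> exists r, order_isomorphic a r.
Proof.
move=> a_inj.
have [f f_lt] : exists f : 'I_k -> 'I_k,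
    forall i j, (a i < a j)%N = (f i < f j)%N.
  exists (fun i => Ordinal (rank_subproof a i)) => i j.
  apply/idP/idP; first exact: rank_lt.
  apply: contraLR; rewrite -!leqNgt leq_eqVlt => /orP[/eqP/a_inj -> //|ji].
  exact: ltnW (rank_lt ji).
have f_inj : injective f.
  move=> i j fij; apply: a_inj; apply/eqP.
  have aN u v : (a u <= a v)%N = (f u <= f v)%N.
    by rewrite leqNgt f_lt -leqNgt.
  by rewrite eqn_leq !aN fij leqnn.
by exists (perm f_inj); apply/order_isomorphicP => i j; rewrite !permE f_lt.
Qed.

(** A permutation of an initial segment is its own rank function, so it is
    determined by its relative order. *)
Lemma eq_order_perm r s :
  (forall i j, (r i < r j)%N = (s i < s j)%N) -> r = s.
Proof.
move=> rs.
have rankE (t : 'S_k) i : #|[set j | (t j < t i)%N]| = t i :> nat.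
  have -> : [set j | (t j < t i)%N] = t @^-1: [set j : 'I_k | (j < t i)%N].
    by apply/setP => j; rewrite !inE.
  rewrite -(card_imset _ (@perm_inj _ t)).
  rewrite (_ : t @: _ = [set j : 'I_k | (j < t i)%N]); last first.
    apply/setP => j; apply/imsetP/idP => [[l + ->]|]; first by rewrite !inE.
    by rewrite inE => jl; exists ((t^-1)%g j); rewrite ?inE permKV.
  have ti := ltnW (ltn_ord (t i)).
  rewrite (_ : [set j | _] = widen_ord ti @: 'I_(t i)).
    rewrite card_imset ?card_ord // => x y /(congr1 val) /= xy.
    exact: val_inj.
  apply/setP => j; rewrite inE; apply/idP/imsetP => [jt|[l _ ->] /=].
    by exists (Ordinal jt) => //; apply: val_inj.
  exact: ltn_ord.
apply/permP => i; apply: val_inj; rewrite -[LHS](rankE r) -[RHS](rankE s).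
by apply: eq_card => j; rewrite !inE rs.
Qed.

Lemma order_isomorphic_uniq a r s :
  order_isomorphic a r -> order_isomorphic a s -> r = s.
Proof.
move=> /order_isomorphicP ar /order_isomorphicP as_.
by apply: eq_order_perm => i j; rewrite -ar.
Qed.

Lemma order_isomorphic_perm (s : 'S_k) a r :
  order_isomorphic (fun i => a (s i)) (s * r)%g = order_isomorphic a r.
Proof.
apply/order_isomorphicP/order_isomorphicP => h i j; last by rewrite !permM.
by have := h ((s^-1)%g i) ((s^-1)%g j); rewrite !permM !permKV.
Qed.

Lemma sum_order_isomorphic (R : pzSemiRingType) a : injective a ->
  \sum_r (order_isomorphic a r)%:R = 1 :> R.
Proof.
move=> /order_isomorphic_ex[r ar].
rewrite (bigD1 r) //= ar big1 ?addr0 // => s sr.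
case: (boolP (order_isomorphic a s)) => // as_.
by rewrite (order_isomorphic_uniq ar as_) eqxx in sr.
Qed.

End Patterns.

Section Independence.
Variables (k l : nat) (o : 'I_k -> 'I_l).
Hypothesis o_inj : injective o.

(** Permuting the entries of [o] is a permutation of the positions that moves
    only the image of [o]. *)
Lemma perm_along_image (s : 'S_k) : exists2 t : 'S_l,
  forall i, t (o i) = o (s i) & perm_on [set o i | i in 'I_k] t.
Proof.
pose f x := if [pick i | o i == x] is Some i then o (s i) else x.
have fo i : f (o i) = o (s i).
  rewrite /f; case: pickP => [j /eqP/o_inj -> //|/(_ i)].
  by rewrite eqxx.
have fN x : x \notin [set o i | i in 'I_k] -> f x = x.
  rewrite /f; case: pickP => // i /eqP <-.
  by rewrite imset_f.
have f_inj : injective f.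
  move=> x y.
  have [/imsetP[i _ ->]|xN] := boolP (x \in [set o i | i in 'I_k]);
  have [/imsetP[j _ ->]|yN] := boolP (y \in [set o i | i in 'I_k]);
    rewrite ?fo ?fN //.
  - by move=> /o_inj/perm_inj ->.
  - by move=> xy; rewrite -xy imset_f in yN.
  - by move=> xy; rewrite xy imset_f in xN.
exists (perm f_inj) => [i|]; first by rewrite permE fo.
apply/fintype.subsetP => x; rewrite inE permE; apply: contraNT => xN.
by rewrite fN.
Qed.

(** The order type of a uniform permutation on the image of [o] is uniform and
    independent of what the permutation does elsewhere: precomposition with a
    permutation of the image of [o] preserves the uniform law and [F], and it
    carries any order type on the image of [o] to any other.  Hence the sum of
    [F] over the permutations with order type [r] does not depend on [r]. *)
Lemma sum_order_isomorphic_indep (R : numFieldType) (F : 'S_l -> R) (r : 'S_k) :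
  (forall t lam : 'S_l, perm_on [set o i | i in 'I_k] t -> F (t * lam)%g = F lam) ->
  \sum_(lam : 'S_l)
    ((order_isomorphic (fun i => lam (o i)) r)%:R - (k`!)%:R^-1) * F lam = 0.
Proof.
move=> F_inv.
pose E r' : R :=
  \sum_(lam : 'S_l) (order_isomorphic (fun i => lam (o i)) r')%:R * F lam.
have E_const r' : E r' = E r.
  have [t to t_on] := perm_along_image (r' * r^-1)%g.
  rewrite /E (reindex_inj (mulgI t)) /=; apply: eq_bigr => lam _.
  rewrite F_inv //; congr (_%:R * _).
  rewrite -(order_isomorphic_perm (r' * r^-1)%g _ r) mulgKV.
  by congr nat_of_bool; apply: eq_order_isomorphic => i; rewrite -to permM.
have E_sum : \sum_r' E r' = \sum_lam F lam.
  rewrite exchange_big; apply: eq_bigr => lam _.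
  rewrite -mulr_suml sum_order_isomorphic ?mul1r // => i j /val_inj/perm_inj.
  exact: o_inj.
have kE : \sum_lam F lam = (k`!)%:R * E r.
  rewrite -E_sum (eq_bigr (fun=> E r)) // sumr_const.
  by rewrite card_Sn mulr_natl.
under eq_bigr do rewrite mulrBl.
rewrite sumrB -mulr_sumr kE mulKf ?subrr //.
Qed.

End Independence.

(** * A fourth moment bound under sparse dependence *)

(** The setting is a finite family of functions [y g] on a finite probability
    space, with a dependency graph [m] of degree at most [D].  Expanding the
    fourth power of their sum, a quadruple with an isolated member contributes
    nothing, and any other quadruple contains two edges that determine two of
    its members up to [D] choices each. *)
Section FourthMoment.
Variables (R : realFieldType) (G L : finType) (y : G -> L -> R).
Variables (m : rel G) (D : nat).
Hypothesis m_sym : symmetric m.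
Hypothesis m_deg : forall g, (\sum_h m g h <= D)%N.

(** After the members [a] and [e], at most [D] choices remain for the neighbour
    [b] of [a], and then at most [D] for the neighbour [c] of any member already
    fixed. *)
Lemma sum_two_edges (h : G -> G -> G -> G) :
  (\sum_a \sum_e \sum_b \sum_c m a b * m c (h a e b) <= #|G| ^ 2 * D ^ 2)%N.
Proof.
have K (F : G -> nat) C : (forall g, F g <= C)%N -> (\sum_g F g <= #|G| * C)%N.
  by move=> FC; rewrite -sum_nat_const; apply: leq_sum => g _.
rewrite -[(#|G| ^ 2)%N]mulnn -mulnA; apply: (K) => a; apply: (K) => e.
rewrite -[(D ^ 2)%N]mulnn.
apply: (@leq_trans (\sum_b m a b * D)%N); last first.
  by rewrite -big_distrl /=; apply: leq_mul.
apply: leq_sum => b _; rewrite -big_distrr /=; apply: leq_mul => //.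
by under eq_bigr do rewrite m_sym.
Qed.

(** Positive as soon as no member of the quadruple is isolated: [a] has a
    neighbour, and so has one of the two remaining members.  The nine products
    are the shapes to which [sum_two_edges] applies. *)
Definition no_isolated (a b c d : G) : nat :=
  m a b * (m c a + m c b + m c d) + m a c * (m b a + m b c + m b d)
  + m a d * (m b a + m b c + m b d).

Lemma sum_no_isolated :
  (\sum_a \sum_b \sum_c \sum_d no_isolated a b c d <= 9 * (#|G| ^ 2 * D ^ 2))%N.
Proof.
have X1 F : (\sum_(b : G) \sum_(c : G) \sum_(d : G) F b c d
  = \sum_d \sum_b \sum_c F b c d)%N.
  by under eq_bigr do rewrite exchange_big; rewrite exchange_big.
have X2 F : (\sum_(b : G) \sum_(c : G) \sum_(d : G) F b c d
  = \sum_d \sum_c \sum_b F b c d)%N.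
  by rewrite X1; apply: eq_bigr => d _; rewrite exchange_big.
have X3 F : (\sum_(b : G) \sum_(c : G) \sum_(d : G) F b c d
  = \sum_c \sum_d \sum_b F b c d)%N.
  by rewrite X2 exchange_big.
have split3 (F F' : G -> G -> G -> G -> nat) :
    (\sum_a \sum_b \sum_c \sum_d (F a b c d + F' a b c d)
    = \sum_a \sum_b \sum_c \sum_d F a b c d
    + \sum_a \sum_b \sum_c \sum_d F' a b c d)%N.
  rewrite -big_split; apply: eq_bigr => a _.
  rewrite -big_split; apply: eq_bigr => b _.
  rewrite -big_split; apply: eq_bigr => c _.
  by rewrite -big_split.
rewrite /no_isolated.
do 3!under eq_bigr do under eq_bigr do under eq_bigr do under eq_bigr do
  rewrite ?mulnDr.
rewrite !split3.
have B1 (h : G -> G -> G -> G) : (\sum_a \sum_b \sum_c \sum_d m a b * m c (h a d b)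
    <= #|G| ^ 2 * D ^ 2)%N.
  rewrite (eq_bigr _ (fun a _ => X1 (fun b c d => m a b * m c (h a d b))%N)).
  exact: sum_two_edges.
have B2 (h : G -> G -> G -> G) : (\sum_a \sum_b \sum_c \sum_d m a c * m b (h a d c)
    <= #|G| ^ 2 * D ^ 2)%N.
  rewrite (eq_bigr _ (fun a _ => X2 (fun b c d => m a c * m b (h a d c))%N)).
  exact: sum_two_edges.
have B3 (h : G -> G -> G -> G) : (\sum_a \sum_b \sum_c \sum_d m a d * m b (h a c d)
    <= #|G| ^ 2 * D ^ 2)%N.
  rewrite (eq_bigr _ (fun a _ => X3 (fun b c d => m a d * m b (h a c d))%N)).
  exact: sum_two_edges.
have := (B1 (fun a _ _ => a), B1 (fun _ _ b => b), B1 (fun _ d _ => d)).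
have := (B2 (fun a _ _ => a), B2 (fun _ _ c => c), B2 (fun _ d _ => d)).
have := (B3 (fun a _ _ => a), B3 (fun _ c _ => c), B3 (fun _ _ d => d)).
move=> /= [[h1 h2] h3] [[h4 h5] h6] [[h7 h8] h9].
set Q := (#|G| ^ 2 * D ^ 2)%N in h1 h2 h3 h4 h5 h6 h7 h8 h9 *.
rewrite (_ : 9 * Q = Q + Q + Q + (Q + Q + Q) + (Q + Q + Q))%N; last by lia.
by do 4!apply: leq_add => //.
Qed.

Hypothesis y_le1 : forall g l, `|y g l| <= 1.
Hypothesis y_indep : forall a b c d, ~~ m a b -> ~~ m a c -> ~~ m a d ->
  \sum_l y a l * y b l * y c l * y d l = 0.

Lemma fourth_moment :
  \sum_l (\sum_g y g l) ^+ 4 <= (#|L| * (9 * (#|G| ^ 2 * D ^ 2)))%:R.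
Proof.
pose T a b c d := \sum_l y a l * y b l * y c l * y d l.
have -> : \sum_l (\sum_g y g l) ^+ 4 = \sum_a \sum_b \sum_c \sum_d T a b c d.
  transitivity (\sum_l \sum_a \sum_b \sum_c \sum_d
      (y a l * y b l * y c l * y d l)).
    apply: eq_bigr => l _; rewrite !exprS expr0 mulr1.
    rewrite mulr_suml; apply: eq_bigr => a _.
    rewrite mulr_suml mulr_sumr; apply: eq_bigr => b _.
    rewrite mulr_suml !mulr_sumr; apply: eq_bigr => c _.
    by rewrite !mulr_sumr; apply: eq_bigr => d _; rewrite !mulrA.
  rewrite exchange_big; apply: eq_bigr => a _.
  rewrite exchange_big; apply: eq_bigr => b _.
  rewrite exchange_big; apply: eq_bigr => c _.
  by rewrite exchange_big.
have T_le a b c d : T a b c d <= #|L|%:R.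
  rewrite -sum1_card natr_sum; apply: ler_sum => l _.
  apply: le_trans (ler_norm _) _; rewrite !normrM.
  by do !apply: mulr_ile1; rewrite ?mulr_ge0.
have T0 a b c d : no_isolated a b c d = 0%N -> T a b c d = 0.
  have swap (e f g h : G) : T e f g h = T a b c d ->
      ~~ m e f -> ~~ m e g -> ~~ m e h -> T a b c d = 0.
    by move=> <- ef eg eh; apply: y_indep.
  rewrite /no_isolated.
  (* The expression [no_isolated a b c d] vanishes only if [a], [b] or [c] is
     isolated, and [T] is symmetric. *)
  have sw1 : T b a c d = T a b c d by apply: eq_bigr => l _; ring.
  have sw2 : T c a b d = T a b c d by apply: eq_bigr => l _; ring.
  move: (swap _ _ _ _ (erefl _)) (swap _ _ _ _ sw1) (swap _ _ _ _ sw2).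
  case: (m a b); case: (m a c); case: (m a d); case: (m b a); case: (m b c);
    case: (m b d); case: (m c a); case: (m c b); case: (m c d) => //= A B C _;
    by [apply: A|apply: B|apply: C].
have T_no a b c d : T a b c d <= #|L|%:R * (no_isolated a b c d)%:R.
  have [n0|n0] := eqVneq (no_isolated a b c d) 0%N.
    by rewrite n0 mulr0 T0.
  by apply: le_trans (T_le _ _ _ _) _; rewrite ler_peMr ?ler1n ?lt0n.
apply: (@le_trans _ _ (#|L|%:R * (\sum_a \sum_b \sum_c \sum_d
    no_isolated a b c d)%N%:R)); last first.
  by rewrite natrM ler_wpM2l // ler_nat sum_no_isolated.
do 4![rewrite natr_sum mulr_sumr; apply: ler_sum => ? _].
exact: T_no.
Qed.

End FourthMoment.

(** * Concentration of pattern counts in a uniform permutation *)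

Section Concentration.
Variables (k l : nat).
Local Notation maps := {ffun 'I_k -> 'I_l}.
Implicit Types (o h : maps) (lam : 'S_l) (r s : 'S_k).

(** The maps [o] need not be increasing: keeping the order type [r] of [o] apart
    from the order type [s] of its image is what makes the count in a tensor
    product a linear combination of such counts. *)
Definition joint_count r s lam : nat :=
  \sum_(o : maps) (order_isomorphic (fun i => o i) r
          && order_isomorphic (fun i => lam (o i)) s).

Lemma sum_ffun_at (i : 'I_k) (x : 'I_l) :
  (\sum_(h : maps) (h i == x) = l ^ k.-1)%N.
Proof.
rewrite -big_mkcond sum1_card.
rewrite (eq_card (B := family (fun j => if j == i then pred1 x else predT))).
  rewrite card_family foldrE big_map big_enum /= (bigD1 i) //= eqxx card1 mul1n.
  rewrite (eq_bigr (fun=> l)) => [|j /negPf ->]; last by rewrite card_ord.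
  rewrite prod_nat_const; congr (_ ^ _)%N.
  by have := cardC (pred1 i); rewrite card1 card_ord add1n => /(congr1 predn).
move=> h; rewrite !inE; apply/eqP/familyP => [/val_inj hi j|/(_ i)].
  by case: eqP => // ->; rewrite inE hi.
by rewrite eqxx inE => /eqP ->.
Qed.

Definition meets : rel maps :=
  fun o h => [exists i, exists j, o i == h j].

Lemma meets_sym : symmetric meets.
Proof.
by move=> o h; apply/existsP/existsP => -[i /existsP[j /eqP ij]];
  exists j; apply/existsP; exists i; rewrite ij.
Qed.

(** A map meeting [o] takes one of the [k] values of [o] at one of its [k]
    arguments, and its other [k - 1] values are free. *)
Lemma meets_degree o : (\sum_(h : maps) meets o h <= k ^ 2 * l ^ k.-1)%N.
Proof.
apply: (@leq_trans (\sum_(h : maps) \sum_i \sum_j (h j == o i))).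
  apply: leq_sum => h _; case: (boolP (meets o h)) => //.
  move=> /existsP[i /existsP[j ij]].
  by rewrite (bigD1 i) //= (bigD1 j) //= eq_sym ij.
rewrite exchange_big /=.
under eq_bigr do rewrite exchange_big /=.
under eq_bigr do under eq_bigr do rewrite sum_ffun_at.
by rewrite !sum_nat_const card_ord mulnA mulnn.
Qed.

Variable R : realFieldType.

Definition deviation r s o lam : R := (order_isomorphic (fun i => o i) r)%:R *
  ((order_isomorphic (fun i => lam (o i)) s)%:R - (k`!)%:R^-1).

Lemma deviation_le1 r s o lam : `|deviation r s o lam| <= 1.
Proof.
have k1 : (k`!)%:R^-1 <= 1 :> R by rewrite invf_le1 ?ler1n ?ltr0n ?fact_gt0.
have k0 : 0 <= (k`!)%:R^-1 :> R by rewrite invr_ge0.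
rewrite ler_norml /deviation.
by do 2![case: order_isomorphic] => /=; rewrite ?mul1r ?mul0r; apply/andP; split;
  lra.
Qed.

(** The factor at [o1] is centred, and the other three do not change when [lam]
    is precomposed with a permutation of the image of [o1]. *)
Lemma deviation_indep r s o1 o2 o3 o4 :
  ~~ meets o1 o2 -> ~~ meets o1 o3 -> ~~ meets o1 o4 ->
  \sum_(lam : 'S_l) deviation r s o1 lam * deviation r s o2 lam *
    deviation r s o3 lam * deviation r s o4 lam = 0.
Proof.
move=> m2 m3 m4.
have [hr|hr] := boolP (order_isomorphic (fun i => o1 i) r); last first.
  by rewrite big1 // => lam _; rewrite /deviation (negPf hr) !mul0r.
have o1_inj : injective o1.
  by move=> i j ij; apply: (order_isomorphic_inj hr); rewrite ij.
have dev_on h t lam : ~~ meets o1 h -> perm_on [set o1 i | i in 'I_k] t ->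
    deviation r s h (t * lam)%g = deviation r s h lam.
  move=> m1h tP; rewrite /deviation; congr (_ * (_%:R - _)).
  congr nat_of_bool; apply: eq_order_isomorphic => i.
  rewrite permM (out_perm tP) //; apply: contra m1h => /imsetP[j _ hj].
  by apply/existsP; exists j; apply/existsP; exists i; rewrite hj.
rewrite -[RHS](sum_order_isomorphic_indep o1_inj (F := fun lam =>
  deviation r s o2 lam * deviation r s o3 lam * deviation r s o4 lam) s).
  by apply: eq_bigr => lam _; rewrite {1}/deviation hr mul1r !mulrA.
by move=> t lam tP; rewrite !dev_on.
Qed.

Lemma deviation_moment r s :
  \sum_(lam : 'S_l) (\sum_(o : maps) deviation r s o lam) ^+ 4 <=
  (l`! * (9 * ((l ^ k) ^ 2 * (k ^ 2 * l ^ k.-1) ^ 2)))%:R.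
Proof.
have := @fourth_moment R _ _ (deviation r s) meets _ meets_sym meets_degree
  (deviation_le1 r s) (@deviation_indep r s).
by rewrite card_ffun !card_ord card_Sn.
Qed.

(** Relabelling the arguments exchanges the order types, so the injective maps
    are shared equally between the [k!] of them. *)
Lemma card_order_isomorphic r :
  (k`! * \sum_(o : maps) order_isomorphic (fun i => o i) r = l ^_ k)%N.
Proof.
have E s : (\sum_(o : maps) order_isomorphic (fun i => o i) s =
           \sum_(o : maps) order_isomorphic (fun i => o i) r)%N.
  pose g (t : 'S_k) o := [ffun i => o (t i)].
  have gK t : cancel (g t) (g t^-1)%g.
    by move=> o; apply/ffunP => i; rewrite !ffunE permKV.
  rewrite (reindex_inj (can_inj (gK (s * r^-1)%g))) /=; apply: eq_bigr => o _.
  rewrite -(order_isomorphic_perm (s * r^-1)%g _ r) mulgKV.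
  by congr nat_of_bool; apply: eq_order_isomorphic => i; rewrite ffunE.
transitivity (\sum_(s : 'S_k) \sum_(o : maps) order_isomorphic (fun i => o i) s)%N.
  by rewrite (eq_bigr _ (fun s _ => E s)) sum_nat_const card_Sn.
have -> : (l ^_ k = #|[set o : maps | injectiveb o]|)%N.
  by rewrite card_inj_ffuns !card_ord.
rewrite exchange_big -sum1_card [RHS]big_mkcond /=; apply: eq_bigr => o _.
rewrite inE; case: injectiveP => [inj_o|inj_o].
  have := @sum_order_isomorphic k nat (fun i => o i).
  rewrite (eq_bigr (fun r => nat_of_bool (order_isomorphic (fun i => o i) r))).
    by apply=> i j /val_inj/inj_o.
  by move=> ? _; rewrite natn.
rewrite big1 // => s _; case: (boolP (order_isomorphic _ s)) => // os.
by case: inj_o => i j ij; apply: (order_isomorphic_inj os); rewrite ij.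
Qed.

(** So [joint_count] has exact mean [l ^_ k / k!^2], and its deviation from the
    mean is the sum to which [fourth_moment] applies. *)
Lemma sum_deviation r s lam :
  \sum_(o : maps) deviation r s o lam
  = (joint_count r s lam)%:R - (l ^_ k)%:R / (k`!)%:R ^+ 2.
Proof.
have k0 : (k`!)%:R != 0 :> R by rewrite pnatr_eq0 -lt0n fact_gt0.
rewrite -(card_order_isomorphic r) natrM !natr_sum /deviation.
rewrite (eq_bigr (fun o : maps =>
  (order_isomorphic (fun i => o i) r
   && order_isomorphic (fun i => lam (o i)) s)%:R
  - (order_isomorphic (fun i => o i) r)%:R * (k`!)%:R^-1)).
  rewrite sumrB -mulr_suml; congr (_ - _).
  by field.
by move=> o _; rewrite mulrBr -natrM mulnb.
Qed.

(** Markov's inequality for the fourth power. *)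
Lemma deviation_tail r s (e : R) : 0 < e -> (0 < l)%N ->
  #|[set lam : 'S_l |
      e * (l ^ k)%:R <= `|\sum_(o : maps) deviation r s o lam|]|%:R / (l`!)%:R
  <= 9 * (k ^ 4)%:R / e ^+ 4 / (l ^ 2)%:R.
Proof.
move=> e0 l0.
have lk0 : 0 < (l ^ k)%:R :> R by rewrite ltr0n expn_gt0 l0.
have lf0 : 0 < (l`!)%:R :> R by rewrite ltr0n fact_gt0.
have l20 : 0 < (l ^ 2)%:R :> R by rewrite ltr0n expn_gt0 l0.
set B := [set lam : 'S_l | _].
have markov : #|B|%:R * (e * (l ^ k)%:R) ^+ 4 <=
    \sum_(lam : 'S_l) (\sum_(o : maps) deviation r s o lam) ^+ 4.
  rewrite -sum1_card natr_sum mulr_suml big_mkcond /=.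
  apply: ler_sum => lam _; rewrite inE; case: ifP => [h|_]; last first.
    by rewrite -[4%N]/(2 * 2)%N exprM sqr_ge0.
  rewrite mul1r -[leRHS]ger0_norm ?normrX.
    by rewrite lerXn2r // nnegrE ?mulr_ge0 // ltW.
  by rewrite -[4%N]/(2 * 2)%N exprM sqr_ge0.
have {markov} := le_trans markov (deviation_moment r s).
rewrite ler_pdivrMr // -ler_pdivlMr ?exprn_gt0 ?mulr_gt0 //.
move=> /le_trans; apply.
have -> : (l`! * (9 * ((l ^ k) ^ 2 * (k ^ 2 * l ^ k.-1) ^ 2)))%:R =
   (l`!)%:R * 9 * (k ^ 4)%:R * (l ^ k)%:R ^+ 4 / (l ^ 2)%:R :> R.
  apply/(mulIf (lt0r_neq0 l20)); rewrite mulfVK ?lt0r_neq0 //.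
  rewrite -!natrX -!natrM; congr (_%:R).
  case: k => [|n]; first by rewrite !(exp0n, mul0n, muln0).
  by rewrite /= (expnS l n); ring.
rewrite exprMn le_eqVlt; apply/orP; left; apply/eqP.
by field; rewrite (lt0r_neq0 e0) (lt0r_neq0 lk0) pnatr_eq0 -lt0n l0.
Qed.

End Concentration.

(** * Almost sure convergence *)

Section AlmostSure.
Local Open Scope classical_set_scope.
Variables (R : realType) (d : measure_display) (Omega : measurableType d).
Variable P : probability Omega R.

Lemma uniform_perm_set_le (l : nat) (X : Omega -> 'S_l) (B : {set 'S_l}) :
  uniform_perm P X ->
  measurable (X @^-1` [set s | s \in B]) /\
  (P (X @^-1` [set s | s \in B]) <= (#|B|%:R / (l`!)%:R)%:E)%E.
Proof.
move=> Xu; rewrite cardE.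
rewrite (_ : [set s | s \in B] = [set s | s \in enum B]); last first.
  by apply/seteqP; split => s /=; rewrite mem_enum.
elim: (enum B) => [|x s [ms Ps]].
  rewrite (_ : _ @^-1` _ = set0); last by apply/seteqP; split.
  by rewrite measure0 mul0r.
rewrite (_ : _ @^-1` _ = X @^-1` [set x] `|` X @^-1` [set y | y \in s]).
  have [mx Px] := Xu x; split; first exact: measurableU.
  apply: le_trans (measureU2 _ mx ms) _.
  rewrite /= -natr1 mulrDl mul1r EFinD addeC; apply: leeD => //.
  by rewrite le_eqVlt; apply/orP; left; apply/eqP; exact: Px.
apply/seteqP; split => w /=; rewrite inE.
  by move=> /orP[/eqP ->|]; [left|right].
by case=> [->|->]; rewrite ?eqxx ?orbT.
Qed.

(** Telescoping: [1 / (n + 1)^2 <= 1 / n - 1 / (n + 1)]. *)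
Lemma sum_inv_sqr_le n :
  \sum_(0 <= i < n.+1) ((i.+1 ^ 2)%:R : R)^-1 <= 2 - n.+1%:R^-1.
Proof.
elim: n => [|n IHn]; first by rewrite big_nat1 invr1; lra.
rewrite big_nat_recr //=; apply: le_trans (lerD IHn (lexx _)) _.
rewrite -subr_ge0 natrX.
have n0 : 0 < n.+1%:R :> R by rewrite ltr0n.
have n1 : n.+2%:R = n.+1%:R + 1 :> R by rewrite -natr1.
rewrite n1; set x : R := n.+1%:R in n0 *.
have x1 : 0 < x + 1 by lra.
rewrite (_ : _ - _ = (x * (x + 1) ^+ 2)^-1).
  by rewrite invr_ge0 mulr_ge0 ?ltW // exprn_gt0.
by field; rewrite !gt_eqF.
Qed.

Lemma borel_cantelli_inv_sqr (F : (set Omega)^nat) (C : R) : 0 <= C ->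
  (forall n, measurable (F n)) ->
  (forall n, (P (F n) <= (C / (n.+1 ^ 2)%:R)%:E)%E) ->
  {ae P, forall w, \forall n \near \oo, ~ F n w}.
Proof.
move=> C0 mF PF; exists (lim_sup_set F); split.
- by apply: bigcap_measurable => // n _; apply: bigcup_measurable.
- apply: lim_sup_set_cvg0 => //.
  apply: (@le_lt_trans _ _ (C * 2)%:E); last exact: ltry.
  apply: lime_le; first exact: is_cvg_nneseries.
  apply: nearW => n.
  apply: (@le_trans _ _ (\sum_(0 <= i < n.+1) (C / (i.+1 ^ 2)%:R)%:E)%E).
    rewrite big_nat_recr //=; apply: (@le_trans _ _
      (\sum_(0 <= i < n) (C / (i.+1 ^ 2)%:R)%:E)%E); first exact: lee_sum.
    by rewrite leeDl // lee_fin divr_ge0.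
  rewrite sumEFin lee_fin -mulr_sumr ler_wpM2l //.
  by apply: le_trans (sum_inv_sqr_le n) _; rewrite gerBl invr_ge0.
- move=> w /= nw n _; apply: contrapT => hn; apply: nw.
  exists n => // j /= nj Fj; apply: hn.
  by exists j.
Qed.

Variable lambda : forall l : nat, Omega -> 'S_l.+1.
Hypothesis lambda_unif : forall l, uniform_perm P (lambda l).

(** The bad events at the rational levels [1 / (j + 1)] are countably many, and
    [borel_cantelli_inv_sqr] applies to each level. *)
Lemma ae_deviation_cvg (k : nat) (r s : 'S_k) :
  {ae P, forall w, (\sum_(o : {ffun 'I_k -> 'I_l.+1})
      deviation R r s o (lambda l w)) / (l.+1 ^ k)%:R @[l --> \oo] --> (0 : R)}.
Proof.
pose B j l := finset (fun lam : 'S_l.+1 => j.+1%:R^-1 * (l.+1 ^ k)%:R <=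
  `|\sum_(o : {ffun 'I_k -> 'I_l.+1}) deviation R r s o lam|).
pose bad j l := lambda l @^-1` [set lam | lam \in B j l].
have : forall j, {ae P, forall w, \forall l \near \oo, ~ bad j l w}.
  move=> j; pose e : R := j.+1%:R^-1.
  have e0 : 0 < e by rewrite invr_gt0.
  apply: (@borel_cantelli_inv_sqr (bad j) (9 * (k ^ 4)%:R / e ^+ 4)).
  - by apply: divr_ge0; [apply: mulr_ge0|apply/exprn_ge0/ltW].
  - by move=> l; apply: (proj1 (uniform_perm_set_le (B j l) (@lambda_unif l))).
  - move=> l.
    apply: le_trans (proj2 (uniform_perm_set_le (B j l) (@lambda_unif l))) _.
    by rewrite lee_fin; apply: deviation_tail.
move=> /ae_foralln; apply: filterS => w /= badw.
apply/cvgrPdist_lt => e e0.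
have [j je] : exists j, j.+1%:R^-1 < e.
  have := @cvg_harmonic R => /cvgrPdist_lt /(_ e e0)[j _ /(_ j (leqnn j))].
  by rewrite sub0r normrN ger0_norm ?invr_ge0 //; exists j.
have := badw j; apply: filterS => l /= badl.
rewrite sub0r normrN normrM normfV (ger0_norm (_ : 0 <= (l.+1 ^ k)%:R)) //.
have lk0 : 0 < (l.+1 ^ k)%:R :> R by rewrite ltr0n expn_gt0.
rewrite ltr_pdivrMr //; apply: lt_trans (_ : j.+1%:R^-1 * (l.+1 ^ k)%:R < _).
  rewrite ltNge; apply/negP => h; apply: badl.
  by rewrite /bad /= /B inE.
by rewrite ltr_pM2r.
Qed.

End AlmostSure.

(** * Asymptotics of binomial coefficients *)

Section Asymptotics.
Local Open Scope classical_set_scope.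
Variable R : realType.

Lemma cvg_ffact_expn (k : nat) :
  (n ^_ k)%:R / (n ^ k)%:R @[n --> \oo] --> (1 : R).
Proof.
elim: k => [|k IHk].
  apply: cvg_near_cst; apply: nearW => n.
  by rewrite ffactn0 expn0 divr1.
rewrite -[1 in X in _ --> X]mulr1.
have H : (n - k)%N%:R / n%:R @[n --> \oo] --> (1 : R).
  apply: (@squeeze_cvgr _ _ _ _ (fun n => 1 - k%:R * n%:R^-1) (fun=> 1)).
  - exists 1%N => // n /= n1.
    have n0 : 0 < n%:R :> R by rewrite ltr0n.
    apply/andP; split; last by rewrite ler_pdivrMr // mul1r ler_nat leq_subr.
    rewrite ler_pdivlMr // mulrBl mul1r mulfVK ?gt_eqF // lerBlDr -natrD ler_nat.
    by lia.
  - rewrite -[1 in X in _ --> X]subr0 -[0 in X in _ --> X](mulr0 k%:R).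
    apply: cvgB; first exact: cvg_cst.
    apply: cvgM; first exact: cvg_cst.
    by rewrite -(cvg_shiftS (fun n => n%:R^-1 : R)); exact: cvg_harmonic.
  - exact: cvg_cst.
rewrite (_ : (fun n => _) = (fun n => (n ^_ k)%:R / (n ^ k)%:R *
    ((n - k)%N%:R / n%:R))); first exact: cvgM IHk H.
by apply/funext => n; rewrite ffactnSr expnSr !natrM mulf_div.
Qed.

Lemma cvgny_mulS (n : nat) : (0 < n)%N -> (fun l => n * l.+1)%N @ \oo --> \oo.
Proof.
move=> n0; apply/cvgnyPge => A; exists A => // l /= Al.
by apply: leq_trans (leq_pmull _ n0); apply: ltnW.
Qed.

End Asymptotics.

(** * Densities as counts of increasing maps *)

Section DensityCount.
Variables (k N : nat).
Implicit Types (A : {set 'I_N}).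

Lemma sorted_enum_set A : sorted (relpre val ltn) (enum A).
Proof.
rewrite {1}/enum_mem; apply: sorted_filter.
  by move=> x y z; apply: ltn_trans.
by rewrite -sorted_map -enumT val_enum_ord iota_ltn_sorted.
Qed.

(** Both lists are strictly sorted and have the same members. *)
Lemma enum_imset_increasing (f : 'I_k -> 'I_N) :
  order_isomorphic (fun i => f i) 1%g ->
  enum [set f i | i in 'I_k] = [seq f i | i <- enum 'I_k].
Proof.
move=> /order_isomorphicP f_incr.
apply: (@irr_sorted_eq _ (relpre val ltn)).
- by move=> x y z; apply: ltn_trans.
- by move=> x; apply: ltnn.
- exact: sorted_enum_set.
- rewrite sorted_map; have := iota_ltn_sorted 0 k.
  rewrite -val_enum_ord sorted_map; apply: sub_sorted => i j /= ij.
  by rewrite f_incr !perm1.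
move=> x; rewrite mem_enum; apply/imsetP/mapP => -[i _ ->]; exists i => //.
by rewrite mem_enum.
Qed.

Lemma nth_enum_imset (f : 'I_k -> 'I_N) (x0 : 'I_N) (i : 'I_k) :
  order_isomorphic (fun i => f i) 1%g ->
  nth x0 (enum [set f i | i in 'I_k]) i = f i.
Proof.
move=> f_incr; rewrite enum_imset_increasing //.
by rewrite (nth_map i) ?size_enum_ord //= nth_ord_enum.
Qed.

Lemma restriction_imset (f : 'I_k -> 'I_N) (tau : 'S_N) (i : 'I_k) :
  order_isomorphic (fun i => f i) 1%g ->
  restriction tau [set f i | i in 'I_k] i = tau (f i).
Proof.
move=> f_incr; rewrite /restriction (nth_map (f i)) ?nth_enum_imset //.
by rewrite enum_imset_increasing // size_map size_enum_ord.
Qed.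

Lemma increasing_enum A : #|A| = k -> exists f : {ffun 'I_k -> 'I_N},
  order_isomorphic (fun i => f i) 1%g /\ A = [set f i | i in 'I_k].
Proof.
move=> Ak; exists [ffun i => enum_val (cast_ord (esym Ak) i)]; split.
  have f_lt (i j : 'I_k) : (i < j)%N ->
      (enum_val (cast_ord (esym Ak) i) < enum_val (cast_ord (esym Ak) j))%N.
    move=> ij; pose x0 := enum_val (cast_ord (esym Ak) i).
    rewrite !(enum_val_nth x0) /=.
    apply: (sorted_ltn_nth (leT := relpre val ltn)) (sorted_enum_set A) _ _ _ _ _.
    - by move=> x y z; apply: ltn_trans.
    - by rewrite inE -cardE Ak.
    - by rewrite inE -cardE Ak.
    - exact: ij.
  apply/order_isomorphicP => i j; rewrite !ffunE !perm1.
  case: (ltngtP i j) => [|ji|/val_inj ->]; last by rewrite ltnn.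
    exact: f_lt.
  by apply/negbTE; rewrite -leqNgt ltnW // f_lt.
apply/setP => x; apply/idP/imsetP => [xA|[i _ ->]].
  exists (cast_ord Ak (enum_rank_in xA x)) => //.
  by rewrite ffunE cast_ordK enum_rankK_in.
by rewrite ffunE; apply: enum_valP.
Qed.

(** A [k]-element set of positions is the image of exactly one increasing map,
    and reading [tau] along the set is composing [tau] with that map. *)
Lemma density_count (R : realType) (pi : 'S_k) (tau : 'S_N) :
  density R pi tau = (\sum_(f : {ffun 'I_k -> 'I_N})
    (order_isomorphic (fun i => f i) 1%g
     && order_isomorphic (fun i => tau (f i)) pi))%N%:R / 'C(N, k)%:R.
Proof.
rewrite /density; congr (_%:R / _).
pose S := [set f : {ffun 'I_k -> 'I_N} | order_isomorphic (fun i => f i) 1%g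
     && order_isomorphic (fun i => tau (f i)) pi].
transitivity #|S|; last first.
  by rewrite -sum1_card big_mkcond /=; apply: eq_bigr => f _; rewrite inE; case: ifP.
pose img (f : {ffun 'I_k -> 'I_N}) := [set f i | i in 'I_k].
rewrite -(card_in_imset (f := img)); last first.
  move=> f g; rewrite !inE => /andP[f_incr _] /andP[g_incr _] fg.
  apply/ffunP => i.
  by have := nth_enum_imset (f i) i g_incr; rewrite -/(img g) -fg nth_enum_imset.
apply: eq_card => A; rewrite inE; apply/andP/imsetP => [[/eqP Ak oA]|].
  have [f [f_incr AE]] := increasing_enum Ak; exists f => //.
  rewrite inE f_incr /= -(@eq_order_isomorphic _ (fun i => restriction tau A i)) //.
  by move=> i; rewrite AE restriction_imset.
move=> [f]; rewrite inE => /andP[f_incr of_] ->; split.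
  rewrite card_imset ?card_ord // => i j ij.
  by apply: (order_isomorphic_inj f_incr); rewrite ij.
rewrite (@eq_order_isomorphic _ _ (fun i => tau (f i))) // => i.
by rewrite restriction_imset.
Qed.
End DensityCount.

(** * Occurrences of a pattern in a tensor product *)

Section TensorCount.
Variables (k n l : nat).
Local Notation blocks := {ffun 'I_k -> 'I_n}.
Local Notation offsets := {ffun 'I_k -> 'I_l}.
Implicit Types (b : blocks) (o : offsets).
Implicit Types (r s pi : 'S_k).

Definition lex_isomorphic (a : 'I_k -> nat) r (pi : 'S_k) : bool :=
  [forall i, forall j, ((a i < a j) || ((a i == a j) && (r i < r j)))%N
                       == (pi i < pi j)%N].

(** Since [c i < l], the number [a i * l + c i] encodes the pair [(a i, c i)] in
    lexicographic order, and only the order type [r] of [c] matters. *)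
Lemma lex_isomorphicE (a c : 'I_k -> nat) r (pi : 'S_k) :
  (forall i, c i < l)%N -> order_isomorphic c r ->
  order_isomorphic (fun i => a i * l + c i)%N pi = lex_isomorphic a r pi.
Proof.
move=> cl /order_isomorphicP cr.
apply: eq_forallb => i; apply: eq_forallb => j; congr (_ == _).
have ci := cl i; have cj := cl j; rewrite -cr.
have step u v : (u < v)%N -> (u * l + l <= v * l)%N.
  by move=> uv; rewrite addnC -mulSn leq_mul2r uv orbT.
case: (ltngtP (a i) (a j)) => [ij|ji|->]; last by rewrite ltn_add2l.
  by have := step _ _ ij; lia.
by have := step _ _ ji; lia.
Qed.

Definition block_weight (tau : 'S_n) (pi : 'S_k) b r s : bool :=
  lex_isomorphic (fun i => b i) r 1%g && lex_isomorphic (fun i => tau (b i)) s pi.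

Definition tensor_hit (tau : 'S_n) (gam : 'S_l) (pi : 'S_k) b o : bool :=
  order_isomorphic (fun i => b i * l + o i)%N 1%g
  && order_isomorphic (fun i => tau (b i) * l + gam (o i))%N pi.

Lemma sum_tensor_hit (tau : 'S_n) (gam : 'S_l) (pi : 'S_k) :
  (\sum_(f : {ffun 'I_k -> 'I_(n * l)})
    (order_isomorphic (fun i => f i) 1%g
     && order_isomorphic (fun i => tensor tau gam (f i)) pi)
  = \sum_(b : blocks) \sum_(o : offsets) tensor_hit tau gam pi b o)%N.
Proof.
rewrite pair_bigA /=.
pose join (bo : blocks * offsets) :=
  [ffun i => index_of (bo.1 i) (bo.2 i)].
pose cut (f : {ffun 'I_k -> 'I_(n * l)}) :=
  ([ffun i => block (f i)], [ffun i => offset (f i)]).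
have joinK : cancel join cut.
  by case=> b o; congr (_, _); apply/ffunP => i;
    rewrite !ffunE ?block_index ?offset_index.
have cutK : cancel cut join.
  by move=> f; apply/ffunP => i; rewrite !ffunE index_block_offset.
rewrite (reindex join) /=; last by exists cut => f _; [exact: joinK|exact: cutK].
apply: eq_bigr => -[b o] _; congr (nat_of_bool (_ && _)).
  by apply: eq_order_isomorphic => i; rewrite ffunE.
by apply: eq_order_isomorphic => i; rewrite ffunE tensorE.
Qed.

Lemma sum_order_pair (gam : 'S_l) (o : offsets)
    (F : 'S_k -> 'S_k -> bool) (G : bool) :
  injective o ->
  (forall r s, order_isomorphic (fun i => o i) r ->
    order_isomorphic (fun i => gam (o i)) s -> G = F r s) ->
  (nat_of_bool G = \sum_(r : 'S_k) \sum_(s : 'S_k) F r s *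
    (order_isomorphic (fun i => o i) r
     && order_isomorphic (fun i => gam (o i)) s))%N.
Proof.
move=> inj_o GF.
have [r hr] : exists r, order_isomorphic (fun i => o i) r.
  by apply: order_isomorphic_ex => i j /val_inj/inj_o.
have [s hs] : exists s, order_isomorphic (fun i => gam (o i)) s.
  by apply: order_isomorphic_ex => i j /val_inj/perm_inj/inj_o.
rewrite (bigD1 r) //= [X in (_ + X)%N]big1 => [|r' r'r].
  rewrite addn0 (bigD1 s) //= [X in (_ + X)%N]big1 => [|s' s's].
    by rewrite hr hs muln1 addn0 (GF r s).
  case: (boolP (order_isomorphic _ s')) => [hs'|]; last by rewrite andbF muln0.
  by rewrite (order_isomorphic_uniq hs hs') eqxx in s's.
rewrite big1 // => s' _.
case: (boolP (order_isomorphic _ r')) => [hr'|]; last by rewrite muln0.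
by rewrite (order_isomorphic_uniq hr hr') eqxx in r'r.
Qed.

(** For injective [o], exactly one pair of order types [r, s] is realised, which
    turns the count into a combination of joint counts.  The remaining maps [o]
    are of lower order, so a crude bound on their contribution is enough. *)
Lemma tensor_count_bounds (tau : 'S_n) (gam : 'S_l) (pi : 'S_k) (M m : nat) :
  M = (\sum_(b : blocks) \sum_(o : offsets)
         tensor_hit tau gam pi b o)%N ->
  m = (\sum_(r : 'S_k) \sum_(s : 'S_k)
        (\sum_(b : blocks) block_weight tau pi b r s)
        * joint_count r s gam)%N ->
  (m <= M <= m + n ^ k * (l ^ k - l ^_ k))%N.
Proof.
move=> MD mD.
have mE : m = (\sum_(b : blocks) \sum_(o : offsets | injectiveb o)
    tensor_hit tau gam pi b o)%N.
  transitivity (\sum_(b : blocks) \sum_(o : offsets)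
    \sum_(r : 'S_k) \sum_(s : 'S_k) block_weight tau pi b r s *
    (order_isomorphic (fun i => o i) r
     && order_isomorphic (fun i => gam (o i)) s))%N.
    rewrite mD /joint_count.
    under eq_bigr do under eq_bigr do rewrite big_distrl /=.
    under eq_bigr do under eq_bigr do under eq_bigr do rewrite big_distrr /=.
    under eq_bigr do rewrite exchange_big /=.
    rewrite exchange_big /=; apply: eq_bigr => b _.
    under eq_bigr do rewrite exchange_big /=.
    by rewrite exchange_big.
  apply: eq_bigr => b _; rewrite [RHS]big_mkcond /=; apply: eq_bigr => o _.
  case: injectiveP => [inj_o|ninj_o].
    rewrite -(@sum_order_pair gam o _ (tensor_hit tau gam pi b o)) //.
    move=> r s hr hs; rewrite /tensor_hit /block_weight.
    rewrite (lex_isomorphicE _ _ _ hr) ?(lex_isomorphicE _ _ _ hs) // => i;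
      exact: ltn_ord.
  apply: big1 => r _; apply: big1 => s _.
  case: (boolP (order_isomorphic _ r)) => [hr|]; last by rewrite muln0.
  by case: ninj_o => i j ij; apply: (order_isomorphic_inj hr); rewrite ij.
have ME : M = (m + \sum_(b : blocks) \sum_(o : offsets | ~~ injectiveb o)
    tensor_hit tau gam pi b o)%N.
  rewrite MD mE -big_split; apply: eq_bigr => b _.
  by rewrite (bigID (fun o => injectiveb o)).
rewrite ME leq_addr leq_add2l.
have -> : (n ^ k = \sum_(b : blocks) 1)%N.
  by rewrite sum1_card card_ffun !card_ord.
rewrite big_distrl /=; apply: leq_sum => b _; rewrite mul1n.
have -> : (l ^ k - l ^_ k = \sum_(o : offsets | ~~ injectiveb o) 1)%N.
  rewrite sum1_card.
  have := cardC (fun o : offsets => injectiveb o).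
  have := card_inj_ffuns 'I_k 'I_l; rewrite cardsE !card_ord => ->.
  rewrite card_ffun !card_ord => <-.
  by rewrite addKn.
by apply: leq_sum => o _; case: tensor_hit.
Qed.

End TensorCount.

(** * Limit densities of a tensor product *)

Section TensorLimit.
Local Open Scope classical_set_scope.
Variable R : realType.
Variables (n k : nat) (tau : 'S_n) (pi : 'S_k).
Hypothesis n_gt0 : (0 < n)%N.

Definition limit_weight : nat := (\sum_(r : 'S_k) \sum_(s : 'S_k)
  \sum_(b : {ffun 'I_k -> 'I_n}) block_weight tau pi b r s)%N.

(** Divide the count of occurrences and the binomial coefficient by [l^k]: the
    joint counts tend to [1 / k!^2], the non-injective offsets disappear, and
    [C(n l, k) / l^k] tends to [n^k / k!]. *)
Lemma density_tensor_cvg (gam : forall l, 'S_l.+1) :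
  (forall r s : 'S_k, (\sum_(o : {ffun 'I_k -> 'I_l.+1})
      deviation R r s o (gam l)) / (l.+1 ^ k)%:R @[l --> \oo] --> (0 : R)) ->
  density R pi (tensor tau (gam l)) @[l --> \oo] -->
    (limit_weight%:R / ((k`!)%:R * (n ^ k)%:R) : R).
Proof.
move=> dev0.
have q0 l : (l.+1 ^ k)%:R != 0 :> R by rewrite pnatr_eq0 -lt0n expn_gt0.
have f0 : (k`!)%:R != 0 :> R by rewrite pnatr_eq0 -lt0n fact_gt0.
have nk0 : (n ^ k)%:R != 0 :> R by rewrite pnatr_eq0 -lt0n expn_gt0 n_gt0.
have ffact_cvg : (l.+1 ^_ k)%:R / (l.+1 ^ k)%:R @[l --> \oo] --> (1 : R).
  rewrite (cvg_shiftS (fun l => (l ^_ k)%:R / (l ^ k)%:R : R)).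
  exact: cvg_ffact_expn.
have joint_cvg (r s : 'S_k) :
    (joint_count r s (gam l))%:R / (l.+1 ^ k)%:R @[l --> \oo]
    --> ((k`!)%:R ^- 2 : R).
  rewrite (_ : (fun l => _) = (fun l => (\sum_(o : {ffun 'I_k -> 'I_l.+1})
      deviation R r s o (gam l)) / (l.+1 ^ k)%:R +
      (l.+1 ^_ k)%:R / (l.+1 ^ k)%:R * (k`!)%:R ^- 2)); last first.
    apply/funext => l; rewrite sum_deviation.
    by field; rewrite f0 q0.
  rewrite -[X in _ --> X]add0r -[X in _ --> _ + X]mul1r.
  by apply: cvgD => //; apply: cvgM => //; apply: cvg_cst.
pose m l := (\sum_(r : 'S_k) \sum_(s : 'S_k)
        (\sum_(b : {ffun 'I_k -> 'I_n}) block_weight tau pi b r s)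
        * joint_count r s (gam l))%N.
have m_cvg : (m l)%:R / (l.+1 ^ k)%:R @[l --> \oo] -->
    (limit_weight%:R * (k`!)%:R ^- 2 : R).
  rewrite (_ : (fun l => _) = (fun l => \sum_(r : 'S_k) \sum_(s : 'S_k)
      (\sum_(b : {ffun 'I_k -> 'I_n}) block_weight tau pi b r s)%N%:R *
        ((joint_count r s (gam l))%:R / (l.+1 ^ k)%:R))); last first.
    apply/funext => l; rewrite /m natr_sum mulr_suml; apply: eq_bigr => r _.
    rewrite natr_sum mulr_suml; apply: eq_bigr => s _.
    by rewrite natrM mulrA.
  rewrite /limit_weight natr_sum mulr_suml.
  apply: (cvg_big add_continuous) => r _; rewrite natr_sum mulr_suml.
  apply: (cvg_big add_continuous) => s _.
  by apply: cvgM => //; apply: cvg_cst.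
pose M l := (\sum_(b : {ffun 'I_k -> 'I_n}) \sum_(o : {ffun 'I_k -> 'I_l.+1})
         tensor_hit tau (gam l) pi b o)%N.
have M_cvg : (M l)%:R / (l.+1 ^ k)%:R @[l --> \oo] -->
    (limit_weight%:R * (k`!)%:R ^- 2 : R).
  apply: (@squeeze_cvgr _ _ _ _ (fun l => (m l)%:R / (l.+1 ^ k)%:R)
    (fun l => (m l)%:R / (l.+1 ^ k)%:R +
       (n ^ k)%:R * (1 - (l.+1 ^_ k)%:R / (l.+1 ^ k)%:R))) => //.
  - apply: nearW => l.
    have /andP[mM Mm] :=
      @tensor_count_bounds _ _ _ tau (gam l) pi (M l) (m l) erefl erefl.
    have q_gt0 : 0 < (l.+1 ^ k)%:R :> R by rewrite lt0r q0 ler0n.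
    rewrite ler_pM2r ?invr_gt0 // ler_nat mM /=.
    rewrite ler_pdivrMr // mulrDl mulfVK // -mulrA mulrBl mul1r mulfVK //.
    have le_q : (l.+1 ^_ k <= l.+1 ^ k)%N.
      have := @card_inj_ffuns 'I_k 'I_l.+1; rewrite !card_ord => <-.
      by apply: leq_trans (max_card _) _; rewrite card_ffun !card_ord.
    by rewrite -natrB // -natrM -natrD ler_nat.
  - rewrite -[X in _ --> X]addr0 -[X in _ --> _ + X](mulr0 (n ^ k)%:R).
    apply: cvgD => //; apply: cvgM; first exact: cvg_cst.
    rewrite -[X in _ --> X](subrr 1); apply: cvgB => //; exact: cvg_cst.
have bin_cvg : 'C(n * l.+1, k)%:R / (l.+1 ^ k)%:R @[l --> \oo] -->
    ((n ^ k)%:R / (k`!)%:R : R).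
  rewrite (_ : (fun l => _) = (fun l => ((n * l.+1) ^_ k)%:R / ((n * l.+1) ^ k)%:R *
      ((n ^ k)%:R / (k`!)%:R))); last first.
    apply/funext => l; rewrite -bin_ffact natrM expnMn natrM.
    by field; rewrite f0 q0 nk0.
  rewrite -[X in _ --> X]mul1r; apply: cvgM; last exact: cvg_cst.
  apply: (@cvg_comp _ _ _ (fun l => n * l.+1)%N
    (fun N => (N ^_ k)%:R / (N ^ k)%:R : R)).
    exact: cvgny_mulS.
  exact: cvg_ffact_expn.
rewrite (_ : (fun l => _) = (fun l => (M l)%:R / (l.+1 ^ k)%:R /
   ('C(n * l.+1, k)%:R / (l.+1 ^ k)%:R))); last first.
  apply/funext => l; rewrite density_count sum_tensor_hit -/(M l).
  by rewrite invf_div mulrA mulfVK.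
rewrite (_ : _ / _ = limit_weight%:R * (k`!)%:R ^- 2 / ((n ^ k)%:R / (k`!)%:R)).
  apply: cvgM => //; apply: cvgV => //.
  by rewrite mulf_neq0 // invr_neq0.
by field; rewrite f0 nk0.
Qed.

End TensorLimit.

Section Inflatable.
Local Open Scope classical_set_scope.
Variables (R : realType) (d : measure_display) (Omega : measurableType d).
Variables (P : probability Omega R) (lambda : forall l : nat, Omega -> 'S_l.+1).
Hypothesis lambda_unif : forall l : nat, uniform_perm P (lambda l).

Lemma ae_forall_count (T : countType) (Q : T -> Omega -> Prop) :
  (forall t, {ae P, forall w, Q t w}) -> {ae P, forall w, forall t, Q t w}.
Proof.
move=> Qae.
have : forall m, {ae P, forall w, if unpickle m is Some t then Q t w else True}.
  by move=> m; case: (unpickle m : option T) => [t|]; [exact: Qae|exact: aeW].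
move=> /ae_foralln; apply: filterS => w Qw t.
by have := Qw (pickle t); rewrite pickleK.
Qed.

Lemma ae_density_tensor_cvg (n : nat) (tau : 'S_n) : (0 < n)%N ->
  {ae P, forall w, forall k (pi : 'S_k),
    density R pi (tensor tau (lambda l w)) @[l --> \oo] -->
      ((limit_weight tau pi)%:R / ((k`!)%:R * (n ^ k)%:R) : R)}.
Proof.
move=> n0.
have : forall k, {ae P, forall w, forall r s : 'S_k,
    (\sum_(o : {ffun 'I_k -> 'I_l.+1}) deviation R r s o (lambda l w))
      / (l.+1 ^ k)%:R @[l --> \oo] --> (0 : R)}.
  move=> k; apply: ae_forall_count => r; apply: ae_forall_count => s.
  exact: ae_deviation_cvg.
move=> /ae_foralln; apply: filterS => w dev0 k pi.
exact: density_tensor_cvg.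
Qed.

(** Almost surely all densities converge to their limit weights; as a
    probability is not the zero measure, some outcome of an inflatable sequence
    does so too, and there the limits can be compared. *)
Lemma inflatableP (n k : nat) (tau : 'S_n) : (0 < n)%N ->
  inflatable P lambda k tau <->
  forall pi : 'S_k, limit_weight tau pi = (n ^ k)%N.
Proof.
move=> n0; have lim := ae_density_tensor_cvg tau n0.
have f0 : (k`!)%:R != 0 :> R by rewrite pnatr_eq0 -lt0n fact_gt0.
have nk0 : (n ^ k)%:R != 0 :> R by rewrite pnatr_eq0 -lt0n expn_gt0 n0.
split=> [infl pi|W].
  have PF : ProperFilter (almost_everywhere P).
    apply: ae_properfilter_algebraOfSetsType.
    by have /= -> := @probability_setT _ _ _ P; exact: lte01.
  have [w [/(_ k pi) wlim [_ _ /(_ pi) wsym]]] := filter_ex (filterI lim infl).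
  have e : (limit_weight tau pi)%:R / ((k`!)%:R * (n ^ k)%:R) = (k`!)%:R^-1 :> R.
    exact: (cvg_unique _ wlim wsym).
  move/(congr1 (fun x : R => x * ((k`!)%:R * (n ^ k)%:R))): e.
  rewrite mulfVK ?mulf_neq0 // mulKf // => /eqP.
  by rewrite eqr_nat => /eqP.
apply: filterS lim => w wlim; split.
- exact: cvgny_mulS.
- by move=> m pi _; apply: cvgP; exact: wlim.
- move=> pi; have := wlim k pi; rewrite W.
  by rewrite invfM mulrCA mulfV // mulr1.
Qed.

End Inflatable.

(** * Patterns of length three *)

Local Notation i0 := (ord0 : 'I_3).
Local Notation i1 := (@Ordinal 3 1 isT).
Local Notation i2 := (ord_max : 'I_3).

Section SumsOverSmallTuples.

Lemma ord3_cases (Q : 'I_3 -> Prop) : Q i0 -> Q i1 -> Q i2 -> forall i, Q i.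
Proof.
move=> Q0 Q1 Q2 [[|[|[|m]]] // im].
- by rewrite (_ : Ordinal im = i0) //; apply: val_inj.
- by rewrite (_ : Ordinal im = i1) //; apply: val_inj.
- by rewrite (_ : Ordinal im = i2) //; apply: val_inj.
Qed.

Lemma ord2_cases (Q : 'I_2 -> Prop) : Q ord0 -> Q ord_max -> forall i, Q i.
Proof.
move=> Q0 Q1 [[|[|m]] // im].
- by rewrite (_ : Ordinal im = ord0) //; apply: val_inj.
- by rewrite (_ : Ordinal im = ord_max) //; apply: val_inj.
Qed.

Lemma sum_ffun3 (T : finType) (F : T -> T -> T -> nat) :
  (\sum_(b : {ffun 'I_3 -> T}) F (b i0) (b i1) (b i2)
  = \sum_x \sum_y \sum_z F x y z)%N.
Proof.
pose join (t : T * T * T) : {ffun 'I_3 -> T} :=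
  [ffun i => tnth [tuple t.1.1; t.1.2; t.2] i].
rewrite (reindex join) /=; last first.
  exists (fun b : {ffun 'I_3 -> T} => (b i0, b i1, b i2)) => [[[x y] z]|b] _.
    by rewrite !ffunE !(tnth_nth x).
  by apply/ffunP; apply: ord3_cases; rewrite ffunE (tnth_nth (b i0)).
rewrite !pair_bigA /=; apply: eq_bigr => -[[x y] z] _.
by rewrite !ffunE !(tnth_nth x).
Qed.

Lemma sum_ffun2 (T : finType) (F : T -> T -> nat) :
  (\sum_(b : {ffun 'I_2 -> T}) F (b ord0) (b ord_max)
  = \sum_x \sum_y F x y)%N.
Proof.
pose join (t : T * T) : {ffun 'I_2 -> T} := [ffun i => tnth [tuple t.1; t.2] i].
rewrite (reindex join) /=; last first.
  exists (fun b : {ffun 'I_2 -> T} => (b ord0, b ord_max)) => [[x y]|b] _.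
    by rewrite !ffunE !(tnth_nth x).
  by apply/ffunP; apply: ord2_cases; rewrite ffunE (tnth_nth (b ord0)).
rewrite pair_bigA /=; apply: eq_bigr => -[x y] _.
by rewrite !ffunE !(tnth_nth x).
Qed.

(** An order type of length three is recorded by its comparisons [0 < 1],
    [0 < 2] and [1 < 2]; by transitivity six of the eight triples occur. *)
Definition sum_patterns (g : bool -> bool -> bool -> nat) : nat :=
  g true true true + g true true false + g false true true
  + g true false false + g false false true + g false false false.

Lemma sum_perm3 (g : bool -> bool -> bool -> nat) :
  (\sum_(r : 'S_3) g (r i0 < r i1) (r i0 < r i2) (r i1 < r i2)
  = sum_patterns g)%N.
Proof.
pose G (x y z : 'I_3) := if uniq [:: x; y; z] then
   g (x < y)%N (x < z)%N (y < z)%N else 0%N.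
have inj3 (b : {ffun 'I_3 -> 'I_3}) :
    injectiveb b = uniq [:: b i0; b i1; b i2].
  apply/injectiveP/idP => [b_inj|]; first by rewrite /= !inE !(inj_eq b_inj).
  rewrite /= !inE !negb_or !andbT => /andP[/andP[/eqP n01 /eqP n02] /eqP n12].
  apply: ord3_cases; apply: ord3_cases => // e; exfalso; auto.
transitivity (\sum_(b : {ffun 'I_3 -> 'I_3}) G (b i0) (b i1) (b i2))%N.
  rewrite /G; under [RHS]eq_bigr do rewrite -inj3.
  rewrite -big_mkcond /=.
  rewrite (reindex_onto (fun r : 'S_3 => pval r) (insubd (1%g : 'S_3))) /=.
    apply: eq_big => [r|r _]; last by rewrite -!pvalE.
    by rewrite (valP r) /=; apply/esym/eqP/valKd.
  by move=> b b_inj; apply: insubdK.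
rewrite sum_ffun3 /G /sum_patterns !big_ord_recl !big_ord0 /=.
have [b0 b1] : bump 0 0 = 1%N /\ bump 0 1 = 2%N by [].
rewrite /= !addn0 !add0n !b0 !b1 /=.
by rewrite !addnA.
Qed.

(** Lexicographic comparison is total because [r] is injective, so the
    comparisons of the pairs with [i < j] determine all others. *)
Lemma lex_isomorphic_total k (a : 'I_k -> nat) (r : 'S_k) i j : i != j ->
  ((a i < a j) || ((a i == a j) && (r i < r j)))%N =
  ~~ ((a j < a i) || ((a j == a i) && (r j < r i)))%N.
Proof.
move=> ij; case: (ltngtP (a i) (a j)) => //= _.
case: (ltngtP (r i) (r j)) => //= /val_inj/perm_inj e.
by rewrite e eqxx in ij.
Qed.

Lemma lex_isomorphic3 (a : 'I_3 -> nat) (r pi : 'S_3) :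
  lex_isomorphic a r pi =
  [&& ((a i0 < a i1) || ((a i0 == a i1) && (r i0 < r i1))) == (pi i0 < pi i1),
      ((a i0 < a i2) || ((a i0 == a i2) && (r i0 < r i2))) == (pi i0 < pi i2) &
      ((a i1 < a i2) || ((a i1 == a i2) && (r i1 < r i2))) == (pi i1 < pi i2)]%N.
Proof.
apply/forallP/and3P => [h|[/eqP h01 /eqP h02 /eqP h12]].
  by split; [have /forallP := h i0|have /forallP := h i0|have /forallP := h i1];
    apply.
have tot i j : i != j -> (pi i < pi j)%N = ~~ (pi j < pi i)%N.
  move=> ij; case: (ltngtP (pi i) (pi j)) => // /val_inj/perm_inj e.
  by rewrite e eqxx in ij.
apply: ord3_cases; apply/forallP; apply: ord3_cases; apply/eqP => //.
all: rewrite ?ltnn ?andbF //.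
- by rewrite (@lex_isomorphic_total _ a r i1 i0) // h01 -tot.
- by rewrite (@lex_isomorphic_total _ a r i2 i0) // h02 -tot.
- by rewrite (@lex_isomorphic_total _ a r i2 i1) // h12 -tot.
Qed.

Lemma order_isomorphic_lex k (a : 'I_k -> nat) (r pi : 'S_k) : injective a ->
  order_isomorphic a pi = lex_isomorphic a r pi.
Proof.
move=> a_inj; do 2![apply: eq_forallb => ?]; congr (_ == _).
rewrite (inj_eq a_inj); case: eqP => [->|_]; first by rewrite !ltnn.
by rewrite orbF.
Qed.

Lemma order_isomorphic3 (a : 'I_3 -> nat) (pi : 'S_3) : injective a ->
  order_isomorphic a pi =
  [&& (a i0 < a i1) == (pi i0 < pi i1), (a i0 < a i2) == (pi i0 < pi i2) &
      (a i1 < a i2) == (pi i1 < pi i2)]%N.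
Proof.
move=> a_inj; rewrite (order_isomorphic_lex 1%g) // lex_isomorphic3.
by rewrite !(inj_eq a_inj) /= !orbF.
Qed.

Lemma increasing3 (a : 'I_3 -> nat) :
  order_isomorphic a 1%g = (a i0 < a i1 < a i2)%N.
Proof.
apply/idP/andP => [/order_isomorphicP h|[a01 a12]].
  by rewrite !h !perm1.
have a02 := ltn_trans a01 a12.
rewrite order_isomorphic3 ?perm1 ?a01 ?a02 ?a12 //.
by apply: ord3_cases; apply: ord3_cases => // e; exfalso; lia.
Qed.

Lemma order_isomorphic2 (a : 'I_2 -> nat) (pi : 'S_2) : injective a ->
  order_isomorphic a pi = ((a ord0 < a ord_max) == (pi ord0 < pi ord_max))%N.
Proof.
move=> a_inj.
have flip (f : 'I_2 -> nat) : injective f ->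
    (f ord_max < f ord0)%N = ~~ (f ord0 < f ord_max)%N.
  by move=> f_inj; case: ltngtP => // /f_inj.
have pi_inj : injective (fun i => pi i : nat) by move=> i j /val_inj/perm_inj.
apply/order_isomorphicP/eqP => [-> //|h].
apply: ord2_cases; apply: ord2_cases; rewrite ?ltnn //.
by rewrite (flip a) // (flip (fun i => pi i : nat)) // h.
Qed.

Lemma increasing2 (a : 'I_2 -> nat) :
  order_isomorphic a 1%g = (a ord0 < a ord_max)%N.
Proof.
apply/idP/idP => [/order_isomorphicP ->|a01]; first by rewrite !perm1.
rewrite order_isomorphic2 ?perm1 ?a01 //.
by apply: ord2_cases; apply: ord2_cases => // e; exfalso; lia.
Qed.

Definition lex_weight (a b c : nat) (p q r : bool) : nat :=
  sum_patterns (fun u v w => [&& ((a < b) || ((a == b) && u)) == p,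
    ((a < c) || ((a == c) && v)) == q & ((b < c) || ((b == c) && w)) == r])%N.

Lemma sum_lex_isomorphic3 (a : 'I_3 -> nat) (pi : 'S_3) :
  (\sum_(r : 'S_3) lex_isomorphic a r pi = lex_weight (a i0) (a i1) (a i2)
     (pi i0 < pi i1) (pi i0 < pi i2) (pi i1 < pi i2))%N.
Proof.
by rewrite /lex_weight -sum_perm3; apply: eq_bigr => r _; rewrite lex_isomorphic3.
Qed.

Lemma limit_weight3 n (tau : 'S_n) (pi : 'S_3) :
  (limit_weight tau pi = \sum_(x : 'I_n) \sum_(y : 'I_n) \sum_(z : 'I_n)
    lex_weight x y z true true true *
    lex_weight (tau x) (tau y) (tau z)
      (pi i0 < pi i1) (pi i0 < pi i2) (pi i1 < pi i2))%N.
Proof.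
rewrite -(sum_ffun3 (fun x y z : 'I_n => lex_weight x y z true true true *
    lex_weight (tau x) (tau y) (tau z)
      (pi i0 < pi i1) (pi i0 < pi i2) (pi i1 < pi i2)))%N.
rewrite /limit_weight; under eq_bigr do rewrite exchange_big /=.
rewrite exchange_big /=; apply: eq_bigr => b _.
have := sum_lex_isomorphic3 (fun i => b i) 1%g; rewrite !perm1 /= => <-.
have := sum_lex_isomorphic3 (fun i => tau (b i)) pi => /= <-.
rewrite big_distrl /=; apply: eq_bigr => r _.
by rewrite big_distrr /=; apply: eq_bigr => s _; rewrite mulnb.
Qed.

(** One summand for each way in which [x <= y <= z] may hold.  If the three are
    distinct, strictly increasing positions are compatible with all [6] order
    types [r] of the offsets; if exactly two coincide, [3] remain, and if all
    coincide, [1].  When the values fit, the order types [s] of the values of the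
    offsets are as many, whence the coefficients [36], [9] and [1]. *)
Lemma lex_weight_prod (x y z x' y' z' : nat) (p q r : bool) :
  (x == y) = (x' == y') -> (x == z) = (x' == z') -> (y == z) = (y' == z') ->
  (p == r) ==> (q == p) ->
  (lex_weight x y z true true true * lex_weight x' y' z' p q r =
  36 * ((x < y < z) && [&& (x' < y') == p, (x' < z') == q & (y' < z') == r])
  + 9 * ((x == y) && ((x < z) && (((x' < z') == q) && (q == r))))
  + 9 * ((y == z) && ((x < y) && (((x' < y') == p) && (p == q))))
  + ((x == y) && (y == z)))%N.
Proof.
rewrite /lex_weight /sum_patterns.
case: (ltngtP x y) => xy; case: (ltngtP y z) => yz; case: (ltngtP x z) => xz;
  try (exfalso; lia);
  move=> e1 e2 e3; rewrite -e1 -e2 -e3;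
  try (move/esym/eqP: e1 => e1); try (move/esym/eqP: e2 => e2);
  try (move/esym/eqP: e3 => e3); subst; rewrite ?ltnn /=;
  move: p q r; do ?[move: (_ < _)%N].
all: by do ?case.
Qed.
End SumsOverSmallTuples.

Section PatternCounts.
Variables (n : nat) (tau : 'S_n).

Definition pair_count (p : bool) : nat := (\sum_(x : 'I_n) \sum_(y : 'I_n)
  ((x < y) && ((tau x < tau y) == p)))%N.

Definition triple_count (p q r : bool) : nat :=
  (\sum_(x : 'I_n) \sum_(y : 'I_n) \sum_(z : 'I_n) ((x < y < z)
   && [&& (tau x < tau y) == p, (tau x < tau z) == q & (tau y < tau z) == r]))%N.

Lemma density2 (R : realType) (pi : 'S_2) : density R pi tau =
  (pair_count (pi ord0 < pi ord_max)%N)%:R / 'C(n, 2)%:R.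
Proof.
rewrite density_count; congr (_%:R / _).
rewrite /pair_count; set p := (pi ord0 < pi ord_max)%N.
rewrite -(sum_ffun2 (fun x y : 'I_n => (x < y) && ((tau x < tau y) == p)))%N.
apply: eq_bigr => f _; congr nat_of_bool; rewrite increasing2.
case: (boolP (_ < _)%N) => //= f_incr.
rewrite order_isomorphic2 // => i j /val_inj/perm_inj fij.
apply: (@order_isomorphic_inj _ (fun i => f i) 1%g); last by rewrite fij.
by rewrite increasing2.
Qed.

Lemma density3 (R : realType) (pi : 'S_3) : density R pi tau =
  (triple_count (pi i0 < pi i1) (pi i0 < pi i2) (pi i1 < pi i2))%N%:R
  / 'C(n, 3)%:R.
Proof.
rewrite density_count; congr (_%:R / _).
rewrite /triple_count; set p := (pi i0 < pi i1)%N.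
set q := (pi i0 < pi i2)%N; set r := (pi i1 < pi i2)%N.
rewrite -(sum_ffun3 (fun x y z : 'I_n => (x < y < z) &&
  [&& (tau x < tau y) == p, (tau x < tau z) == q & (tau y < tau z) == r]))%N.
apply: eq_bigr => f _; congr nat_of_bool; rewrite increasing3.
case: (boolP (_ < _ < _)%N) => //= f_incr.
rewrite order_isomorphic3 // => i j /val_inj/perm_inj fij.
apply: (@order_isomorphic_inj _ (fun i => f i) 1%g); last by rewrite fij.
by rewrite increasing3.
Qed.

Lemma triple_valid (x y z : 'I_n) : (x < y < z)%N ->
  (((tau x < tau y) == (tau y < tau z)) ==> ((tau x < tau z) == (tau x < tau y)))%N.
Proof.
move=> xyz; have xz : (tau x != tau z :> nat).
  rewrite (inj_eq val_inj) (inj_eq perm_inj); apply/eqP => e.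
  by rewrite e in xyz; lia.
by lia.
Qed.

Lemma perm3_valid (pi : 'S_3) :
  (((pi i0 < pi i1) == (pi i1 < pi i2))
   ==> ((pi i0 < pi i2) == (pi i0 < pi i1)))%N.
Proof.
have : pi i0 != pi i2 :> nat by rewrite (inj_eq val_inj) (inj_eq perm_inj).
by lia.
Qed.

Lemma limit_weightE (pi : 'S_3) :
  let p := (pi i0 < pi i1)%N in let q := (pi i0 < pi i2)%N in
  let r := (pi i1 < pi i2)%N in
  (limit_weight tau pi = 36 * triple_count p q r + 9 * (pair_count q * (q == r))
    + 9 * (pair_count p * (p == q)) + n)%N.
Proof.
move=> p q r; rewrite limit_weight3 -/p -/q -/r.
have valid : (p == r) ==> (q == p) := perm3_valid pi.
transitivity (\sum_(x : 'I_n) \sum_(y : 'I_n) \sum_(z : 'I_n)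
  (36 * ((x < y < z) && [&& (tau x < tau y) == p, (tau x < tau z) == q
          & (tau y < tau z) == r])
  + 9 * ((x == y) && ((x < z) && (((tau x < tau z) == q) && (q == r))))
  + 9 * ((y == z) && ((x < y) && (((tau x < tau y) == p) && (p == q))))
  + ((x == y) && (y == z))))%N.
  do 3![apply: eq_bigr => ? _]; rewrite lex_weight_prod //;
  by rewrite !(inj_eq val_inj) (inj_eq perm_inj).
have pick_eq (x : 'I_n) (F : 'I_n -> bool) :
    (\sum_(y : 'I_n) ((x == y) && F y) = F x)%N.
  rewrite (bigD1 x) //= eqxx big1 ?addn0 // => y /negPf yx.
  by rewrite eq_sym yx.
have lin (F1 F2 F3 F4 : 'I_n -> nat) :
    (\sum_(x : 'I_n) (36 * F1 x + 9 * F2 x + 9 * F3 x + F4 x)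
    = 36 * \sum_(x : 'I_n) F1 x + 9 * \sum_(x : 'I_n) F2 x
    + 9 * \sum_(x : 'I_n) F3 x + \sum_(x : 'I_n) F4 x)%N.
  by rewrite 3!big_split -!big_distrr.
under eq_bigr do under eq_bigr do rewrite lin.
under eq_bigr do rewrite lin.
rewrite lin /pair_count; congr (_ + 9 * _ + 9 * _ + _)%N.
- rewrite big_distrl; apply: eq_bigr => x _ /=.
  rewrite exchange_big /= big_distrl /=; apply: eq_bigr => z _.
  by rewrite pick_eq mulnb andbA.
- rewrite big_distrl; apply: eq_bigr => x _ /=.
  rewrite big_distrl /=; apply: eq_bigr => y _.
  by rewrite (pick_eq y (fun=> _)) mulnb andbA.
- rewrite (eq_bigr (fun=> 1%N)) ?sum1_card ?card_ord // => x _.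
  rewrite (eq_bigr (fun y => nat_of_bool ((x == y) && true))) ?pick_eq // => y _.
  rewrite andbT -[RHS]muln1; under eq_bigr do rewrite andbC -mulnb.
  rewrite -big_distrl /= mulnC; congr (_ * _)%N.
  by under eq_bigr do rewrite -[_ == _]andbT; rewrite pick_eq.
Qed.

Lemma pair_countD : (2 * (pair_count true + pair_count false) + n = n * n)%N.
Proof.
pose S := (\sum_(x : 'I_n) \sum_(y : 'I_n) (x < y))%N.
have -> : (pair_count true + pair_count false = S)%N.
  rewrite -big_split; apply: eq_bigr => x _; rewrite -big_split.
  by apply: eq_bigr => y _ /=; case: (x < y)%N; case: (_ < _)%N.
have nn : (\sum_(x : 'I_n) \sum_(y : 'I_n) 1 = n * n)%N.
  by rewrite !sum_nat_const card_ord muln1.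
have S' : (S = \sum_(x : 'I_n) \sum_(y : 'I_n) (y < x))%N by rewrite exchange_big.
rewrite mul2n -addnn {2}S' -nn -[X in (_ + X = _)%N](card_ord n) -sum1_card /S.
rewrite -!big_split; apply: eq_bigr => x _ /=.
rewrite -big_split /= (bigD1 x) //= [in RHS](bigD1 x) //= !ltnn !add0n addnC.
congr (_ + _)%N; apply: eq_bigr => y; rewrite -val_eqE /=.
by case: ltngtP.
Qed.

(** Each ascent [(x, y)] extends to a triple by any of the [n - 2] other
    positions, while a triple contains as many ascents as its pattern has. *)
Lemma pair_count_triples :
  (n * pair_count true = 3 * triple_count true true true
    + 2 * triple_count true true false + 2 * triple_count false true true
    + triple_count true false false + triple_count false false true
    + 2 * pair_count true)%N.
Proof.
pose a (x y : 'I_n) := ((x < y) && (tau x < tau y))%N.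
pose S1 := (\sum_(x : 'I_n) \sum_(y : 'I_n) \sum_(z : 'I_n) (a x y && (y < z)))%N.
pose S2 := (\sum_(x : 'I_n) \sum_(y : 'I_n) \sum_(z : 'I_n) (a x y && (x < z < y)))%N.
pose S3 := (\sum_(x : 'I_n) \sum_(y : 'I_n) \sum_(z : 'I_n) (a x y && (z < x)))%N.
have S2' : S2 = (\sum_(x : 'I_n) \sum_(y : 'I_n) \sum_(z : 'I_n)
    (a x z && (x < y < z)))%N.
  by apply: eq_bigr => x _; rewrite exchange_big.
have S3' : S3 = (\sum_(x : 'I_n) \sum_(y : 'I_n) \sum_(z : 'I_n)
    (a y z && (x < y)))%N.
  rewrite exchange_big /= /S3; under eq_bigr do rewrite exchange_big /=.
  by rewrite exchange_big /=; under eq_bigr do rewrite exchange_big /=;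
    rewrite exchange_big.
have triples : (S1 + S2 + S3 = 3 * triple_count true true true
    + 2 * triple_count true true false + 2 * triple_count false true true
    + triple_count true false false + triple_count false false true)%N.
  rewrite S2' S3' /triple_count !big_distrr -!big_split; apply: eq_bigr => x _ /=.
  rewrite !big_distrr -!big_split; apply: eq_bigr => y _ /=.
  rewrite !big_distrr -!big_split; apply: eq_bigr => z _ /=.
  rewrite /a; have := @triple_valid x y z.
  case: (ltngtP x y) => xy; case: (ltngtP y z) => yz; case: (ltngtP x z) => xz;
    try (exfalso; lia); rewrite ?andbF //= => /(_ isT);
    by do 3!case: (_ < _)%N.
rewrite -triples.
have -> : (2 * pair_count true = \sum_(x : 'I_n) \sum_(y : 'I_n) \sum_(z : 'I_n)
    ((a x y && (z == x)) + (a x y && (z == y))))%N.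
  rewrite /pair_count big_distrr; apply: eq_bigr => x _ /=.
  rewrite big_distrr; apply: eq_bigr => y _ /=.
  have one (u : 'I_n) : (\sum_(z : 'I_n) (a x y && (z == u)) = a x y)%N.
    rewrite (bigD1 u) //= eqxx andbT big1 ?addn0 // => z /negPf ->.
    by rewrite andbF.
  by rewrite big_split /= !one eqb_id mul2n addnn.
rewrite /S1 /S2 /S3 /pair_count -!big_split big_distrr; apply: eq_bigr => x _ /=.
rewrite -!big_split big_distrr; apply: eq_bigr => y _ /=.
rewrite -!big_split eqb_id -/(a x y).
have -> : (n * a x y = \sum_(z : 'I_n) a x y)%N.
  by rewrite sum_nat_const card_ord.
apply: eq_bigr => z _ /=; rewrite -!val_eqE /= /a.
case: (ltngtP x y) => //= xy; case: (_ < _)%N => //=.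
by case: (ltngtP z x) => zx; case: (ltngtP z y) => zy; try (exfalso; lia);
  rewrite ?ltnNge; lia.
Qed.

End PatternCounts.

(** * The linear system for the densities *)

Lemma oneline_lt (w : seq nat) (i j : 'I_(size w)) :
  perm_eq w (iota 1 (size w)) ->
  (oneline w i < oneline w j)%N = (nth 0 w i < nth 0 w j)%N.
Proof. by move=> pw; rewrite -!onelineE. Qed.

Section Equations.
Variables (R : realType) (n : nat) (tau : 'S_n).
Hypothesis n_ge3 : (3 <= n)%N.

Lemma density_oneline2 (a b : nat) : perm_eq [:: a; b] (iota 1 2) ->
  density R (oneline [:: a; b]) tau = (pair_count tau (a < b)%N)%:R / 'C(n, 2)%:R.
Proof.
move=> w; rewrite (density2 tau R (oneline [:: a; b] : 'S_2)).
by congr ((pair_count tau _)%:R / _); apply: (oneline_lt _ _ w).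
Qed.

Lemma density_oneline3 (a b c : nat) : perm_eq [:: a; b; c] (iota 1 3) ->
  density R (oneline [:: a; b; c]) tau
  = (triple_count tau (a < b) (a < c) (b < c))%N%:R / 'C(n, 3)%:R.
Proof.
move=> w; rewrite (density3 tau R (oneline [:: a; b; c] : 'S_3)).
by congr ((triple_count tau _ _ _)%:R / _); apply: (oneline_lt _ _ w).
Qed.

Lemma bin2R : 'C(n, 2)%:R = n%:R * (n%:R - 1) / 2 :> R.
Proof.
have : ('C(n, 2) * 2 = n * (n - 1))%N.
  by rewrite -[2%N in LHS]/(2`!) bin_ffact ffactnS ffactn1 subn1.
move=> /(congr1 (fun m => m%:R : R)).
rewrite (natrM _ 'C(n, 2)) (natrM _ n) natrB; last by lia.
by move=> <-; field.
Qed.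

Lemma bin3R : 'C(n, 3)%:R = n%:R * (n%:R - 1) * (n%:R - 2) / 6 :> R.
Proof.
have : ('C(n, 3) * 6 = n * ((n - 1) * (n - 2)))%N.
  rewrite -[6%N]/(3`!) bin_ffact !ffactnS ffactn0 muln1.
  by rewrite subn1 subn2.
move=> /(congr1 (fun m => m%:R : R)).
rewrite (natrM _ 'C(n, 3)) (natrM _ n) (natrM _ (n - 1)) !natrB; try lia.
by rewrite mulrA => <-; field.
Qed.

Definition pattern_equation (p q r : bool) : Prop :=
  36 * (triple_count tau p q r)%:R + 9 * (pair_count tau q)%:R * (q == r)%:R
  + 9 * (pair_count tau p)%:R * (p == q)%:R + n%:R = n%:R ^+ 3 :> R.

(** The six one-line words listed here are the patterns of the theorem. *)
Lemma perm3_realize (p q r : bool) : (p == r) ==> (q == p) ->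
  exists pi : 'S_3, [/\ (pi i0 < pi i1)%N = p, (pi i0 < pi i2)%N = q
    & (pi i1 < pi i2)%N = r].
Proof.
have R3 (a b c : nat) : perm_eq [:: a; b; c] (iota 1 3) ->
    exists pi : 'S_3, [/\ (pi i0 < pi i1)%N = (a < b)%N,
      (pi i0 < pi i2)%N = (a < c)%N & (pi i1 < pi i2)%N = (b < c)%N].
  by move=> w; exists (oneline [:: a; b; c]); split; apply: (oneline_lt _ _ w).
case: p; case: q; case: r => //= _.
- exact: (R3 1 2 3)%N.
- exact: (R3 1 3 2)%N.
- exact: (R3 2 3 1)%N.
- exact: (R3 2 1 3)%N.
- exact: (R3 3 1 2)%N.
- exact: (R3 3 2 1)%N.
Qed.

Lemma limit_weight_equationsP :
  (forall pi : 'S_3, limit_weight tau pi = (n ^ 3)%N) <->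
  (forall p q r, (p == r) ==> (q == p) -> pattern_equation p q r).
Proof.
have E (pi : 'S_3) : limit_weight tau pi = (n ^ 3)%N <-> pattern_equation
    (pi i0 < pi i1)%N (pi i0 < pi i2)%N (pi i1 < pi i2)%N.
  rewrite limit_weightE /pattern_equation -!mulrA -!natrM -natrX.
  by rewrite -!natrD; split => [->//|/eqP]; rewrite eqr_nat => /eqP.
split=> [W p q r /perm3_realize[pi [<- <- <-]]|W pi].
  by apply/E.
by apply/E/W/perm3_valid.
Qed.

(** Writing [A] and [B] for the numbers of ascents and descents, the pattern
    equations express the six counts of triples through [A] and [B].
    Substituting them in [pair_count_triples] and using [pair_countD] leaves
    [n A = n^2 (n - 1) / 4], hence [A = B = n (n - 1) / 4], which determines
    everything else. *)
Lemma density_equationsP :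
  (forall pi : 'S_3, limit_weight tau pi = (n ^ 3)%N) <->
  [/\ density R (oneline [:: 1; 2]%N) tau = 1 / 2,
      density R (oneline [:: 1; 2; 3]%N) tau
         = (2 * n%:R - 7) / (12 * (n%:R - 2))
      /\ density R (oneline [:: 3; 2; 1]%N) tau
         = (2 * n%:R - 7) / (12 * (n%:R - 2)) &
      [/\ density R (oneline [:: 1; 3; 2]%N) tau
          = (4 * n%:R - 5) / (24 * (n%:R - 2)),
          density R (oneline [:: 2; 1; 3]%N) tau
          = (4 * n%:R - 5) / (24 * (n%:R - 2)),
          density R (oneline [:: 2; 3; 1]%N) tau
          = (4 * n%:R - 5) / (24 * (n%:R - 2)) &
          density R (oneline [:: 3; 1; 2]%N) tau
          = (4 * n%:R - 5) / (24 * (n%:R - 2))]].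
Proof.
apply: (iff_trans limit_weight_equationsP).
have := pair_count_triples tau; have := pair_countD tau.
move=> /(congr1 (fun m => m%:R : R)); rewrite natrD !natrM natrD => D1.
move=> /(congr1 (fun m => m%:R : R)).
rewrite !natrD !natrM => D2.
rewrite density_oneline2 // !density_oneline3 //= bin2R bin3R.
rewrite /pattern_equation.
have N3 : 3 <= n%:R :> R by rewrite ler_nat.
move: D1 D2; set x : R := n%:R in N3 *.
have x0 : x != 0 by apply/eqP; lra.
have x1 : x - 1 != 0 by apply/eqP; lra.
have x2 : x - 2 != 0 by apply/eqP; lra.
split=> [W|].
  have := W false false false isT; have := W false false true isT.
  have := W true false false isT; have := W false true true isT.
  have := W true true false isT; have := W true true true isT.
  rewrite /= !mulr1 !mulr0 !addr0 => T123 T132 T213 T231 T312 T321.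
  have A : (pair_count tau true)%:R = x * (x - 1) / 4.
    by apply: (mulfI x0); lra.
  have B : (pair_count tau false)%:R = x * (x - 1) / 4 by lra.
  have solve (T : R) (c e : R) : T = x * (x - 1) * c ->
      c * 6 = e * (x - 2) -> T / (x * (x - 1) * (x - 2) / 6) = e.
    by move=> -> h; rewrite -[RHS](mulfK x2) -h; field; rewrite x0 x1 x2.
  have e1 : (2 * x - 7) / 72 * 6 = (2 * x - 7) / (12 * (x - 2)) * (x - 2) by field.
  have e2 : (4 * x - 5) / 144 * 6 = (4 * x - 5) / (24 * (x - 2)) * (x - 2) by field.
  split; [|split|split].
  - by rewrite A; field; rewrite x0 x1.
  - by apply: solve e1; lra.
  - by apply: solve e1; lra.
  - by apply: solve e2; lra.
  - by apply: solve e2; lra.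
  - by apply: solve e2; lra.
  - by apply: solve e2; lra.
have y0 : x * (x - 1) * (x - 2) / 6 != 0 by rewrite !mulf_neq0 ?invr_neq0.
have solve (T e : R) : T / (x * (x - 1) * (x - 2) / 6) = e ->
    T = e * (x - 2) * (x * (x - 1) / 6).
  by move=> <-; field; rewrite x0 x1 x2.
have e1 : (2 * x - 7) / (12 * (x - 2)) * (x - 2) * (x * (x - 1) / 6)
    = (2 * x - 7) * (x * (x - 1)) / 72 by field.
have e2 : (4 * x - 5) / (24 * (x - 2)) * (x - 2) * (x * (x - 1) / 6)
    = (4 * x - 5) * (x * (x - 1)) / 144 by field.
move=> [A [/solve T123 /solve T321]].
move=> [/solve T132 /solve T213 /solve T231 /solve T312].
rewrite e1 in T123 T321; rewrite e2 in T132 T213 T231 T312.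
have {}A : (pair_count tau true)%:R = x * (x - 1) / 4.
  by rewrite -[LHS](mulfVK (_ : x * (x - 1) / 2 != 0)) ?A ?mulf_neq0 ?invr_neq0 //;
    field.
have B : (pair_count tau false)%:R = x * (x - 1) / 4 by lra.
by case; case; case => //= _; rewrite ?mulr1 ?mulr0 ?addr0; lra.
Qed.

End Equations.

Theorem theorem13 (R : realType) (d : measure_display)
    (Omega : measurableType d) (P : probability Omega R)
    (lambda : forall l : nat, Omega -> 'S_l.+1)
    (lambda_unif : forall l : nat, uniform_perm P (lambda l))
    (n : nat) (n_ge3 : (3 <= n)%N) (tau : 'S_n) :
  inflatable P lambda 3 tau <->
  [/\ density R (oneline [:: 1; 2]%N) tau = 1 / 2,
      density R (oneline [:: 1; 2; 3]%N) tau
         = (2 * n%:R - 7) / (12 * (n%:R - 2))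
      /\ density R (oneline [:: 3; 2; 1]%N) tau
         = (2 * n%:R - 7) / (12 * (n%:R - 2)) &
      [/\ density R (oneline [:: 1; 3; 2]%N) tau
          = (4 * n%:R - 5) / (24 * (n%:R - 2)),
          density R (oneline [:: 2; 1; 3]%N) tau
          = (4 * n%:R - 5) / (24 * (n%:R - 2)),
          density R (oneline [:: 2; 3; 1]%N) tau
          = (4 * n%:R - 5) / (24 * (n%:R - 2)) &
          density R (oneline [:: 3; 1; 2]%N) tau
          = (4 * n%:R - 5) / (24 * (n%:R - 2))]].
Proof.
apply: iff_trans (density_equationsP R tau n_ge3).
by apply: inflatableP => //; apply: leq_trans n_ge3.
Qed.
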